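(* Let $\mathcal{B}\subset\mathcal{D}$ be a unital inclusion of unital $C^\ast$-algebras and $\mu\in\Sigma_{\mathcal{B}:\mathcal{D}}$. Then there exist a selfadjoint $\alpha\in\mathcal{D}$ and a $\mathbb{C}$-linear map $\sigma:\mathcal{B}\langle\mathcal{X}\rangle\to\mathcal{D}$ satisfying property (P) such that $$B_\mu(b)=\bigl[\alpha\cdot\mathds{1}+\widetilde{\sigma}\bigl(b(\mathds{1}-\mathcal{X}b)^{-1}\bigr)\bigr]\cdot b.$$ Moreover, if $\mu\in\Sigma_{\mathcal{B}:\mathcal{D}}^0$, then the moments of $\sigma$ do not grow faster than exponentially, i.e. $\sigma$ satisfies property (E).
   Context: $\mathcal{B}\langle\mathcal{X}\rangle$ is the $\ast$-algebra freely generated by $\mathcal{B}$ and a selfadjoint symbol $\mathcal{X}$ (not assumed to commute with $\mathcal{B}$). Property (P) for a linear map $\sigma:\mathcal{B}\langle\mathcal{X}\rangle\to\mathcal{D}$: for all positive integers $n$ and all $f_1,\dots,f_n\in\mathcal{B}\langle\mathcal{X}\rangle$, $[\sigma(f_j^\ast f_i)]_{i,j=1}^n\ge0$ in $M_n(\mathcal{D})$. Property (E): there exists $M>0$ such that $\|\sigma(\mathcal{X}b_1\mathcal{X}b_2\cdots\mathcal{X}b_n\mathcal{X})\|\le M^{n+1}\|b_1\|\cdots\|b_n\|$ for all $n$ and all $b_1,\dots,b_n\in\mathcal{B}$. $\Sigma_{\mathcal{B}:\mathcal{D}}$ is the set of unital positive $\mathcal{B}$-bimodule maps $\mathcal{B}\langle\mathcal{X}\rangle\to\mathcal{D}$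 with property (P), and $\Sigma_{\mathcal{B}:\mathcal{D}}^0$ is the subset of those satisfying (E). Boolean cumulants of $\mu$: the multilinear maps $B_{n,\mu}:\mathcal{B}^n\to\mathcal{D}$, $n\ge1$, defined recursively by $$\mu(\mathcal{X}b_1\cdots\mathcal{X}b_n)=\sum_{k=1}^nB_{k,\mu}(b_1,\dots,b_k)\,\mu(\mathcal{X}b_{k+1}\cdots\mathcal{X}b_n)$$ ($\mu$ of the empty word is $1$). $\beta_\mu:\mathcal{B}\langle\mathcal{X}\rangle\to\mathcal{D}$ is the unital $\mathcal{B}$-bimodule map with $\beta_\mu(\mathcal{X}b_1\cdots\mathcal{X}b_n)=B_{n,\mu}(b_1,\dots,b_n)$. Non-commutative functions: $\mathrm{Nilp}(\mathcal{B})=\coprod_{n\ge1}\mathrm{Nilp}(\mathcal{B};n)$, where $\mathrm{Nilp}(\mathcal{B};n)$ is the set of $n\times n$ matrices $b$ over $\mathcal{B}$ with $b^r=0$ for some $r$ when $b$ is viewed as a matrix over the tensor algebra of $\mathcal{B}$ over $\mathbb{C}$ (equivalently $tbt^{-1}$ is strictly upper triangular for some invertible $t\in M_n(\mathbb{C})$). For a linear map $\phi$ on $\mathcal{B}\langle\mathcal{X}\rangle$, $\widetilde\phi$ denotes $\mathrm{Id}_n\otimes\phi$ on $M_n(\mathcal{B}\langle\mathcal{X}\rangle)$ for each $n$; $\mathds{1}$ is the identity matrix of each size; $\mathcal{X}$ stands for $\mathrm{Id}_n\otimes\mathcal{X}$ in $M_n(\mathcal{B}\langle\mathcal{X}\rangle)$;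 $(\mathds{1}-\mathcal{X}b)^{-1}=\sum_{k\ge0}(\mathcal{X}b)^k$, with $\widetilde\phi$ applied termwise. Define $$B_\mu(b)=\widetilde{\beta_\mu}\bigl((\mathds{1}-\mathcal{X}b)^{-1}\bigr)-\mathds{1}=\sum_{k\ge1}\widetilde{\beta_\mu}\bigl((\mathcal{X}b)^k\bigr).$$ The identity in the theorem is an identity of non-commutative functions, i.e. holds for all $n$ and all $b\in\mathrm{Nilp}(\mathcal{B};n)$, where the sums are finite (and, if $\mu\in\Sigma^0_{\mathcal{B}:\mathcal{D}}$, also for $b\in M_n(\mathcal{B})$ of sufficiently small norm, uniformly in $n$). *)

(* Defs.v *)
From HB Require Import structures.
From mathcomp Require Import all_boot all_order all_algebra.
From mathcomp Require Import generic_quotient complex.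
From mathcomp Require Import all_classical reals topology normedtype.
Import Order.TTheory GRing.Theory Num.Theory.
Import numFieldNormedType.Exports.
Set Implicit Arguments.
Unset Strict Implicit.
Unset Printing Implicit Defensive.
Local Open Scope ring_scope.
Local Open Scope classical_set_scope.

HB.mixin Record hasStar (C : numClosedFieldType) A of GRing.Algebra C A := {
  star : A -> A;
  starK : involutive star;
  starD : {morph star : x y / x + y};
  starZ : forall (a : C) (x : A), star (a *: x) = a^* *: star x;
  starM : forall x y : A, star (x * y) = star y * star x
}.

#[short(type="starAlgType")]
HB.structure Definition StarAlgebra (C : numClosedFieldType) :=
  {A of hasStar C A & GRing.Algebra C A}.

(* The norm is real-valued and is not the canonical [`| |] of MathComp: no
   structure there joins rings and normed modules below the number domains.
   [Normc.normc] is the real-valued modulus. *)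
HB.mixin Record isCStar (R : realType) A of StarAlgebra R[i] A := {
  cnorm : A -> R;
  cnormD : forall x y : A, cnorm (x + y) <= cnorm x + cnorm y;
  cnormZ : forall (a : R[i]) (x : A),
    cnorm (a *: x) = Normc.normc a * cnorm x;
  cnorm0_eq0 : forall x : A, cnorm x = 0 -> x = 0;
  cnormM : forall x y : A, cnorm (x * y) <= cnorm x * cnorm y;
  cstar_identity : forall x : A, cnorm (star x * x) = cnorm x ^+ 2;
  cnorm_complete : forall u : nat -> A,
    (forall e : R, 0 < e -> exists N, forall m n, (N <= m)%N -> (N <= n)%N ->
       cnorm (u m - u n) < e) ->
    exists l : A, (fun n => cnorm (u n - l)) @ \oo --> (0 : R)
}.

#[short(type="cstarAlgType")]
HB.structure Definition CStarAlgebra (R : realType) :=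
  {A of isCStar R A & StarAlgebra R[i] A}.

Definition adjmx (C : numClosedFieldType) (A : starAlgType C) m n
  (a : 'M[A]_(m, n)) : 'M[A]_(n, m) := (map_mx star a)^T.

(* Positivity in the C*-algebra M_n(A), as being of the form c^* c. *)
Definition psdmx (C : numClosedFieldType) (A : starAlgType C) n
  (a : 'M[A]_n) : Prop := exists c : 'M[A]_n, a = adjmx c *m c.

(* Norm of the Hilbert module A^n, and the C*-norm of M_n(A): the operator norm
   for its action on A^n. *)
Definition colnorm (R : realType) (A : cstarAlgType R) n (x : 'cV[A]_n) : R :=
  Num.sqrt (cnorm (\sum_i star (x i 0) * x i 0)).

Definition mxcnorm (R : realType) (A : cstarAlgType R) n (a : 'M[A]_n) : R :=
  sup [set colnorm (a *m x) | x in [set x : 'cV[A]_n | colnorm x <= 1]].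

(* Convergence in M_n(A), n fixed, is entrywise norm convergence. *)
Definition mxcvg (R : realType) (A : cstarAlgType R) n
  (u : nat -> 'M[A]_n) (l : 'M[A]_n) : Prop :=
  forall i j, (fun k => cnorm (u k i j - l i j)) @ \oo --> (0 : R).

Definition cstar_inclusion (R : realType) (B D : cstarAlgType R)
  (iota : B -> D) : Prop :=
  (forall b, iota (star b) = star (iota b)) /\
  (forall b, cnorm (iota b) = cnorm b).

Section TensorModule.
Variables (C : comNzRingType) (M V : lmodType C).

(* (m, [:: v1; ...; vn]) stands for m (x) v1 (x) ... (x) vn, and a list of such
   words for their sum. *)
Definition tword : Type := (M * seq V)%type.
HB.instance Definition _ := Choice.on tword.

Record balanced (U : zmodType) (F : tword -> U) : Prop := Balanced {
  balDl : forall m m' s, F (m + m', s) = F (m, s) + F (m', s);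
  balDr : forall m s v v' s',
    F (m, s ++ (v + v') :: s') = F (m, s ++ v :: s') + F (m, s ++ v' :: s');
  balZ : forall (a : C) m s v s',
    F (a *: m, s ++ v :: s') = F (m, s ++ (a *: v) :: s')
}.

Definition weval (U : zmodType) (F : tword -> U) (p : seq tword) : U :=
  \sum_(w <- p) F w.

(* The universal property taken as a definition: two formal sums are
   identified when every balanced multiadditive map agrees on them. *)
Definition tens_eq (p q : seq tword) : Prop :=
  forall (U : zmodType) (F : tword -> U), balanced F -> weval F p = weval F q.

Definition tens_eqb (p q : seq tword) : bool := `[< tens_eq p q >].

Lemma tens_eqb_refl : reflexive tens_eqb.
Proof. by move=> p; apply/asboolP. Qed.

Lemma tens_eqb_sym : symmetric tens_eqb.
Proof.
by move=> p q; apply/asboolP/asboolP => h U F bF; rewrite (h U F bF).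
Qed.

Lemma tens_eqb_trans : transitive tens_eqb.
Proof.
move=> q p r /asboolP h1 /asboolP h2; apply/asboolP => U F bF.
by rewrite (h1 U F bF) (h2 U F bF).
Qed.

Canonical tens_equiv :=
  EquivRel tens_eqb tens_eqb_refl tens_eqb_sym tens_eqb_trans.

Definition tens : Type := {eq_quot tens_equiv}%qT.
HB.instance Definition _ := Choice.on tens.
HB.instance Definition _ := EqQuotient.on tens.

Definition tmk (p : seq tword) : tens := (\pi_tens p)%qT.

Definition tlift (U : zmodType) (F : tword -> U) (x : tens) : U :=
  weval F (repr x).

Lemma tliftE (U : zmodType) (F : tword -> U) (p : seq tword) :
  balanced F -> tlift F (tmk p) = weval F p.
Proof.
move=> bF; rewrite /tlift.
have /eqmodP/asboolP h : (repr (tmk p) = p %[mod tens])%qT by rewrite reprK.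
exact: h.
Qed.

Lemma tens_ext (x y : tens) :
  (forall (U : zmodType) (F : tword -> U), balanced F ->
     tlift F x = tlift F y) -> x = y.
Proof.
move=> h; rewrite -[x]reprK -[y]reprK; apply/eqmodP/asboolP => U F bF.
exact: h.
Qed.

Lemma tmkP (x : tens) : exists p, x = tmk p.
Proof. by exists (repr x); rewrite /tmk reprK. Qed.

Lemma eq_tlift (U : zmodType) (F G : tword -> U) x :
  F =1 G -> tlift F x = tlift G x.
Proof. by move=> h; apply: eq_bigr => w _; rewrite h. Qed.

Lemma tliftD (U : zmodType) (F G : tword -> U) x :
  tlift (fun w => F w + G w) x = tlift F x + tlift G x.
Proof. exact: big_split. Qed.

Definition tzero : tens := tmk [::].
Definition tadd (x y : tens) : tens := tmk (repr x ++ repr y).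
Definition topp (x : tens) : tens := tmk [seq (- w.1, w.2) | w <- repr x].
Definition tscale (a : C) (x : tens) : tens :=
  tmk [seq (a *: w.1, w.2) | w <- repr x].

Section Lift.
Variables (U : zmodType) (F : tword -> U).
Hypothesis bF : balanced F.

Lemma bal0 s : F (0, s) = 0.
Proof. by apply: (addrI (F (0, s))); rewrite -(balDl bF) !addr0. Qed.

Lemma balN m s : F (- m, s) = - F (m, s).
Proof. by apply/eqP; rewrite -addr_eq0 -(balDl bF) addNr bal0. Qed.

Lemma balZl a : balanced (fun w => F (a *: w.1, w.2)).
Proof.
split=> /= [m m' s|m s v v' s'|b m s v s'].
- by rewrite scalerDr (balDl bF).
- by rewrite (balDr bF).
- by rewrite scalerA mulrC -scalerA (balZ bF).
Qed.

Lemma tlift0 : tlift F tzero = 0.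
Proof. by rewrite tliftE // /weval big_nil. Qed.

Lemma tlift_add x y : tlift F (tadd x y) = tlift F x + tlift F y.
Proof. by rewrite tliftE // /weval big_cat. Qed.

Lemma tlift_opp x : tlift F (topp x) = - tlift F x.
Proof.
rewrite tliftE // /weval big_map -sumrN; apply: eq_bigr => -[m s] _ /=.
exact: balN.
Qed.

Lemma tlift_scale a x :
  tlift F (tscale a x) = tlift (fun w => F (a *: w.1, w.2)) x.
Proof. by rewrite tliftE // /weval big_map. Qed.
End Lift.

Fact taddA : associative tadd.
Proof. by move=> x y z; apply: tens_ext => U F bF; rewrite !tlift_add // addrA. Qed.
Fact taddC : commutative tadd.
Proof. by move=> x y; apply: tens_ext => U F bF; rewrite !tlift_add // addrC. Qed.
Fact tadd0 : left_id tzero tadd.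
Proof.
by move=> x; apply: tens_ext => U F bF; rewrite tlift_add // tlift0 // add0r.
Qed.
Fact taddN : left_inverse tzero topp tadd.
Proof.
move=> x; apply: tens_ext => U F bF.
by rewrite tlift_add // tlift_opp // tlift0 // addNr.
Qed.
HB.instance Definition _ := GRing.isZmodule.Build tens taddA taddC tadd0 taddN.

Lemma tliftDr (U : zmodType) (F : tword -> U) x y :
  balanced F -> tlift F (x + y) = tlift F x + tlift F y.
Proof. by move=> bF; exact: (tlift_add bF). Qed.

Fact tscaleA a b x : tscale a (tscale b x) = tscale (a * b) x.
Proof.
apply: tens_ext => U F bF; rewrite !tlift_scale //; last exact: balZl.
by apply: eq_tlift => -[m s] /=; rewrite scalerA.
Qed.
Fact tscale1 : left_id 1 tscale.
Proof.
move=> x; apply: tens_ext => U F bF; rewrite tlift_scale //.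
by apply: eq_tlift => -[m s] /=; rewrite scale1r.
Qed.
Fact tscaleDr : right_distributive tscale +%R.
Proof.
move=> a x y; apply: tens_ext => U F bF.
by rewrite tliftDr // !tlift_scale // tliftDr //; exact: balZl.
Qed.
Fact tscaleDl x : {morph tscale^~ x : a b / a + b}.
Proof.
move=> a b; apply: tens_ext => U F bF.
rewrite tliftDr // !tlift_scale // -tliftD.
by apply: eq_tlift => -[m s] /=; rewrite scalerDl (balDl bF).
Qed.
HB.instance Definition _ :=
  GRing.Zmodule_isLmodule.Build C tens tscaleA tscale1 tscaleDr tscaleDl.

Lemma tliftZ (U : lmodType C) (F : tword -> U) (a : C) x : balanced F ->
  (forall b m s, F (b *: m, s) = b *: F (m, s)) ->
  tlift F (a *: x) = a *: tlift F x.
Proof.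
move=> bF hF; rewrite tlift_scale // scaler_sumr.
by apply: eq_bigr => -[m s] _ /=.
Qed.

Definition wmul_spec (wmul : tword -> tword -> tword) : Prop :=
  forall (U : zmodType) (F : tword -> U), balanced F -> forall w,
    balanced (fun w' => F (wmul w w')) /\ balanced (fun w' => F (wmul w' w)).

Definition tmul (wmul : tword -> tword -> tword) (x y : tens) : tens :=
  tmk [seq wmul w w' | w <- repr x, w' <- repr y].

Section Mul.
Variable wmul : tword -> tword -> tword.
Hypothesis wmulP : wmul_spec wmul.
Local Notation tmul := (tmul wmul).

Lemma tlift_mul (U : zmodType) (F : tword -> U) x y : balanced F ->
  tlift F (tmul x y) = tlift (fun w => tlift (fun w' => F (wmul w w')) y) x.
Proof. by move=> bF; rewrite tliftE // /weval big_allpairs_dep. Qed.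

Lemma bal_mul (U : zmodType) (F : tword -> U) y : balanced F ->
  balanced (fun w => tlift (fun w' => F (wmul w w')) y).
Proof.
move=> bF; split=> [m m' s|m s v v' s'|a m s v s'];
  rewrite -?tliftD; apply: eq_tlift => w';
  have [_ bw] := wmulP bF w'.
- by rewrite (balDl bw).
- by rewrite (balDr bw).
- by rewrite (balZ bw).
Qed.

Lemma tmulA : (forall u v w, wmul u (wmul v w) = wmul (wmul u v) w) ->
  associative tmul.
Proof.
move=> hA x y z; apply: tens_ext => U F bF.
rewrite !tlift_mul //; last exact: bal_mul.
apply: eq_tlift => w; rewrite tlift_mul; last by case: (wmulP bF w).
by apply: eq_tlift => w'; apply: eq_tlift => w''; rewrite hA.
Qed.

Lemma tmul1 w1 : (forall w, wmul w1 w = w) -> left_id (tmk [:: w1]) tmul.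
Proof.
move=> h1 x; apply: tens_ext => U F bF.
rewrite tlift_mul // tliftE; last exact: bal_mul.
by rewrite /weval big_seq1; apply: eq_tlift => w; rewrite h1.
Qed.

Lemma tmulr1 w1 : (forall w, wmul w w1 = w) -> right_id (tmk [:: w1]) tmul.
Proof.
move=> h1 x; apply: tens_ext => U F bF.
rewrite tlift_mul //; apply: eq_tlift => w.
rewrite tliftE; last by case: (wmulP bF w).
by rewrite /weval big_seq1 h1.
Qed.

Lemma tmulDl : left_distributive tmul +%R.
Proof.
move=> x y z; apply: tens_ext => U F bF.
by rewrite tliftDr // !tlift_mul // tliftDr //; exact: bal_mul.
Qed.

Lemma tmulDr : right_distributive tmul +%R.
Proof.
move=> x y z; apply: tens_ext => U F bF.
rewrite tliftDr // !tlift_mul // -tliftD; apply: eq_tlift => w.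
by rewrite tliftDr //; case: (wmulP bF w).
Qed.
End Mul.
End TensorModule.

Section TensorAlgebra.
Variables (C : comNzRingType) (V : lmodType C).

Definition tensalg : Type := tens C^o V.
HB.instance Definition _ := GRing.Lmodule.on tensalg.

Definition cat_wmul (w w' : tword C^o V) : tword C^o V :=
  (w.1 * w'.1, w.2 ++ w'.2).

Lemma cat_wmulP : wmul_spec cat_wmul.
Proof.
move=> U F bF [c t]; split; split=> [m m' s|m s v v' s'|a m s v s'];
  rewrite /cat_wmul /=.
- by rewrite mulrDr (balDl bF).
- by rewrite !catA (balDr bF).
- by rewrite !catA -(balZ bF) -scalerAr.
- by rewrite mulrDl (balDl bF).
- by rewrite -!catA !cat_cons (balDr bF).
- by rewrite -!catA !cat_cons -(balZ bF) -scalerAl.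
Qed.

Definition tensalg_one : tensalg := tmk [:: (1, [::])].
Definition tensalg_mul : tensalg -> tensalg -> tensalg := tmul cat_wmul.

Fact tensalg_mulA : associative tensalg_mul.
Proof.
by apply: (tmulA cat_wmulP) => u v w; rewrite /cat_wmul /= mulrA catA.
Qed.
Fact tensalg_mul1 : left_id tensalg_one tensalg_mul.
Proof. by apply: (tmul1 cat_wmulP) => -[c s]; rewrite /cat_wmul /= mul1r. Qed.
Fact tensalg_mulr1 : right_id tensalg_one tensalg_mul.
Proof.
by apply: (tmulr1 cat_wmulP) => -[c s]; rewrite /cat_wmul /= mulr1 cats0.
Qed.
Fact tensalg_mulDl : left_distributive tensalg_mul +%R.
Proof. exact: (tmulDl cat_wmulP). Qed.
Fact tensalg_mulDr : right_distributive tensalg_mul +%R.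
Proof. exact: (tmulDr cat_wmulP). Qed.
HB.instance Definition _ := GRing.Zmodule_isPzRing.Build tensalg
  tensalg_mulA tensalg_mul1 tensalg_mulr1 tensalg_mulDl tensalg_mulDr.

Definition tens_in (v : V) : tensalg := tmk [:: (1, [:: v])].
End TensorAlgebra.

Section NcPoly.
Variables (C : numClosedFieldType) (B : starAlgType C).

(* The word (b0, [:: b1; ...; bn]) stands for b0 X b1 X ... X bn. *)
Definition ncpoly : Type := tens B B.
HB.instance Definition _ := GRing.Lmodule.on ncpoly.

(* (b0 X ... X bn)(c0 X ... X cm) = b0 X ... X (bn c0) X ... X cm *)
Fixpoint glue (b : B) (s : seq B) (w : tword B B) : tword B B :=
  if s is c :: t then (b, (glue c t w).1 :: (glue c t w).2)
  else (b * w.1, w.2).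

Definition nc_wmul (w w' : tword B B) : tword B B := glue w.1 w.2 w'.

Lemma glue_rcons b s c w :
  glue b (rcons s c) w = (b, s ++ (c * w.1) :: w.2).
Proof. by elim: s b => [|d s IHs] b //=; rewrite IHs. Qed.

Lemma glue_cat b s c s' w :
  glue b (s ++ c :: s') w = (b, s ++ (glue c s' w).1 :: (glue c s' w).2).
Proof. by elim: s b => [|d s IHs] b //=; rewrite IHs. Qed.

Lemma glue1D b b' s w :
  (glue (b + b') s w).1 = (glue b s w).1 + (glue b' s w).1.
Proof. by case: s => //=; rewrite mulrDl. Qed.

Lemma glue1Z a b s w : (glue (a *: b) s w).1 = a *: (glue b s w).1.
Proof. by case: s => //=; rewrite scalerAl. Qed.

Lemma glue2 b b' s w : (glue b s w).2 = (glue b' s w).2.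
Proof. by case: s. Qed.

Lemma glueE b s w : glue b s w = ((glue b s w).1, (glue 0 s w).2).
Proof. by rewrite [LHS]surjective_pairing (glue2 b 0). Qed.

Lemma nc_wmulP : wmul_spec nc_wmul.
Proof.
move=> U F bF [b t]; split; split; rewrite /nc_wmul /=.
- case/lastP: t => [|t c] m m' s /=; first by rewrite mulrDr (balDl bF).
  by rewrite !glue_rcons /= mulrDr (balDr bF).
- case/lastP: t => [|t c] m s v v' s' /=; first by rewrite (balDr bF).
  by rewrite !glue_rcons /= -!cat_cons !catA (balDr bF).
- case/lastP: t => [|t c] a m s v s' /=.
    by rewrite -(balZ bF) scalerAr.
  rewrite !glue_rcons /= -scalerAr -(balZ bF) -!cat_cons !catA.
  by rewrite -(balZ bF).
- move=> m m' s.
  by rewrite (glueE (m + m')) (glueE m) (glueE m') glue1D (balDl bF).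
- move=> m s v v' s'; rewrite !glue_cat glue1D (balDr bF).
  by rewrite (glue2 (v + v') 0) (glue2 v 0) (glue2 v' 0).
- move=> a m s v s'; rewrite !glue_cat glue1Z -(balZ bF).
  by rewrite (glue2 (a *: v) v).
Qed.

Lemma glue_glue b s w w' :
  glue b s (nc_wmul w w') = nc_wmul (glue b s w) w'.
Proof.
rewrite /nc_wmul; elim: s b => [|c s IHs] b /=; last by rewrite IHs.
by case: w => [m [|d t]] /=; rewrite ?mulrA.
Qed.

Definition ncpoly_one : ncpoly := tmk [:: (1, [::])].
Definition ncpoly_mul : ncpoly -> ncpoly -> ncpoly := tmul nc_wmul.

Fact ncpoly_mulA : associative ncpoly_mul.
Proof. by apply: (tmulA nc_wmulP) => u v w; rewrite -glue_glue. Qed.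
Fact ncpoly_mul1 : left_id ncpoly_one ncpoly_mul.
Proof. by apply: (tmul1 nc_wmulP) => -[b s]; rewrite /nc_wmul /= mul1r. Qed.
Fact ncpoly_mulr1 : right_id ncpoly_one ncpoly_mul.
Proof.
apply: (tmulr1 nc_wmulP) => -[b s]; rewrite /nc_wmul /=.
case/lastP: s => [|s c] /=; first by rewrite mulr1.
by rewrite glue_rcons /= mulr1 cats1.
Qed.
Fact ncpoly_mulDl : left_distributive ncpoly_mul +%R.
Proof. exact: (tmulDl nc_wmulP). Qed.
Fact ncpoly_mulDr : right_distributive ncpoly_mul +%R.
Proof. exact: (tmulDr nc_wmulP). Qed.

Fact ncpoly_one_neq0 : ncpoly_one != 0.
Proof.
pose F (w : tword B B) : B := if w.2 is [::] then w.1 else 0.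
have bF : balanced F.
  by split=> [m m' [|c s]|m [|c s]|a m [|c s]] *; rewrite /F //= addr0.
apply/eqP => h; have := tliftE [:: (1, [::])] bF.
rewrite -[tmk _]/ncpoly_one h tlift0 // /weval big_seq1 /F /=.
by move/esym/eqP; rewrite oner_eq0.
Qed.

HB.instance Definition _ := GRing.Zmodule_isNzRing.Build ncpoly
  ncpoly_mulA ncpoly_mul1 ncpoly_mulr1 ncpoly_mulDl ncpoly_mulDr
  ncpoly_one_neq0.

Lemma tlift_ncmul (U : zmodType) (F : tword B B -> U) (x y : ncpoly) :
  balanced F ->
  tlift F (x * y) = tlift (fun w => tlift (fun w' => F (nc_wmul w w')) y) x.
Proof. exact: tlift_mul. Qed.

Fact ncpoly_scalerAl (a : C) (x y : ncpoly) : a *: (x * y) = (a *: x) * y.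
Proof.
apply: tens_ext => U F bF.
rewrite tlift_scale // tlift_ncmul; last exact: balZl.
rewrite tlift_ncmul // tlift_scale; last exact: (bal_mul nc_wmulP).
apply: eq_tlift => -[b s]; apply: eq_tlift => w; rewrite /nc_wmul /=.
by rewrite (glueE (a *: b)) (glueE b) glue1Z.
Qed.
HB.instance Definition _ :=
  GRing.LSemiModule_isLSemiAlgebra.Build C ncpoly ncpoly_scalerAl.

Fact ncpoly_scalerAr (a : C) (x y : ncpoly) : a *: (x * y) = x * (a *: y).
Proof.
apply: tens_ext => U F bF.
rewrite tlift_scale // tlift_ncmul; last exact: balZl.
rewrite tlift_ncmul //; apply: eq_tlift => -[b s].
have [bw _] := nc_wmulP bF (b, s).
rewrite tlift_scale //; apply: eq_tlift => -[b' s']; rewrite /nc_wmul /=.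
case/lastP: s {bw} => [|s c] /=; first by rewrite scalerAr.
by rewrite !glue_rcons /= (balZ bF) scalerAr.
Qed.
HB.instance Definition _ :=
  GRing.LSemiAlgebra_isSemiAlgebra.Build C ncpoly ncpoly_scalerAr.

(* (b0 X b1 ... X bn)^* = bn^* X ... b1^* X b0^* *)
Definition word_of (r : seq B) : tword B B := (head 0 r, behead r).
Definition wstar (w : tword B B) : tword B B :=
  word_of (rev (map star (w.1 :: w.2))).
Definition ncpoly_star (x : ncpoly) : ncpoly := tmk (map wstar (repr x)).

Lemma wstarE b s : wstar (b, s) = word_of (rcons (rev (map star s)) (star b)).
Proof. by rewrite /wstar /= rev_cons. Qed.

Section WordOf.
Variables (U : zmodType) (F : tword B B -> U).
Hypothesis bF : balanced F.

Lemma word_ofD p x y q :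
  F (word_of (p ++ (x + y) :: q)) =
  F (word_of (p ++ x :: q)) + F (word_of (p ++ y :: q)).
Proof. by case: p => [|c p]; rewrite /word_of /= ?(balDl bF) ?(balDr bF). Qed.

Lemma word_ofZ p x (a : C) q y t :
  F (word_of (p ++ (a *: x) :: q ++ y :: t)) =
  F (word_of (p ++ x :: q ++ (a *: y) :: t)).
Proof.
case: p => [|c p]; rewrite /word_of /= ?(balZ bF) // -(balZ bF).
by rewrite -!cat_cons !catA (balZ bF).
Qed.

Lemma bal_wstar : balanced (fun w => F (wstar w)).
Proof.
split=> [m m' s|m s v v' s'|a m s v s'].
- by rewrite !wstarE starD -!cats1 word_ofD.
- rewrite !wstarE !map_cat /= !rev_cat !rev_cons starD -!cats1 -!catA /=.
  by rewrite word_ofD.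
- rewrite !wstarE !map_cat /= !rev_cat !rev_cons !starZ -!cats1 -!catA /=.
  by rewrite word_ofZ.
Qed.
End WordOf.

Lemma wstarK : involutive wstar.
Proof.
case=> b s; rewrite wstarE /wstar /word_of.
set r := rcons _ _; have r0 : r <> [::] by rewrite /r -cats1; case: (rev _).
have -> : (head 0 r, behead r).1 :: (head 0 r, behead r).2 = r by case: r r0.
rewrite /r map_rcons rev_rcons starK map_rev revK /=.
by rewrite -map_comp (eq_map (@starK C B)) map_id.
Qed.

Lemma glue_word_of p z w :
  nc_wmul (word_of (rcons p z)) w = word_of (p ++ (z * w.1) :: w.2).
Proof.
by case: p => [|c p] //=; rewrite /nc_wmul /word_of /= glue_rcons.
Qed.

Lemma wstarM w w' : wstar (nc_wmul w w') = nc_wmul (wstar w') (wstar w).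
Proof.
case: w w' => b s [b' s']; rewrite [wstar (b', s')]wstarE glue_word_of.
case/lastP: s => [|t c].
  by rewrite /nc_wmul /= !wstarE starM /= cats1.
rewrite [wstar (b, rcons t c)]wstarE map_rcons rev_rcons /nc_wmul /=.
by rewrite glue_rcons wstarE map_cat rev_cat /= rev_cons starM -!cats1 -!catA.
Qed.

Lemma tlift_star (U : zmodType) (F : tword B B -> U) x : balanced F ->
  tlift F (ncpoly_star x) = tlift (fun w => F (wstar w)) x.
Proof. by move=> bF; rewrite tliftE // /weval big_map. Qed.

Fact ncpoly_starK : involutive ncpoly_star.
Proof.
move=> x; apply: tens_ext => U F bF; rewrite !tlift_star //; last exact: bal_wstar.
by apply: eq_tlift => w; rewrite wstarK.
Qed.
Fact ncpoly_starD : {morph ncpoly_star : x y / x + y}.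
Proof.
move=> x y; apply: tens_ext => U F bF.
by rewrite tliftDr // !tlift_star // tliftDr //; exact: bal_wstar.
Qed.
Fact ncpoly_starZ (a : C) x : ncpoly_star (a *: x) = a^* *: ncpoly_star x.
Proof.
apply: tens_ext => U F bF; rewrite tlift_scale // !tlift_star //; last first.
  exact: balZl.
rewrite tlift_scale; last exact: bal_wstar.
apply: eq_tlift => -[b s]; rewrite !wstarE /= starZ.
case: (rev _) => [|c t] //=.
by rewrite /word_of /= -!cats1 (balZ bF).
Qed.
Fact ncpoly_starM (x y : ncpoly) :
  ncpoly_star (x * y) = ncpoly_star y * ncpoly_star x.
Proof.
apply: tens_ext => U F bF.
rewrite tlift_star // !tlift_ncmul //; last exact: bal_wstar.
rewrite tlift_star; last exact: (bal_mul nc_wmulP).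
etransitivity; first exact: exchange_big.
apply: eq_bigr => w' _.
rewrite tlift_star; last by case: (nc_wmulP bF (wstar w')).
by apply: eq_bigr => w _; rewrite wstarM.
Qed.
HB.instance Definition _ := hasStar.Build C ncpoly
  ncpoly_starK ncpoly_starD ncpoly_starZ ncpoly_starM.

Definition ncword (w : tword B B) : ncpoly := tmk [:: w].
Definition ncC (b : B) : ncpoly := ncword (b, [::]).
Definition ncX : ncpoly := ncword (1, [:: 1]).


(* X b1 X b2 ... X bn *)
Definition Xword (s : seq B) : ncpoly := \prod_(b <- s) (ncX * ncC b).

Lemma ncwordM w w' : ncword w * ncword w' = ncword (nc_wmul w w').
Proof.
apply: tens_ext => U F bF; rewrite tlift_ncmul //.
rewrite tliftE; last exact: (bal_mul nc_wmulP).
rewrite /weval big_seq1 tliftE; last by case: (nc_wmulP bF w).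
by rewrite tliftE // /weval !big_seq1.
Qed.

Lemma tlift_mulw (U : zmodType) (F : tword B B -> U) (x : ncpoly) w :
  balanced F -> tlift F (x * ncword w) = tlift (fun v => F (nc_wmul v w)) x.
Proof.
move=> bF; rewrite tlift_ncmul //; apply: eq_tlift => v.
by rewrite tliftE ?/weval ?big_seq1 //; case: (nc_wmulP bF v).
Qed.

Lemma tlift_wmul (U : zmodType) (F : tword B B -> U) (x : ncpoly) w :
  balanced F -> tlift F (ncword w * x) = tlift (fun v => F (nc_wmul w v)) x.
Proof.
move=> bF; rewrite tlift_ncmul // tliftE ?/weval ?big_seq1 //.
exact: (bal_mul nc_wmulP).
Qed.

Lemma ncC1 : ncC 1 = 1. Proof. by []. Qed.

Lemma ncCM b b' : ncC (b * b') = ncC b * ncC b'.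
Proof. by rewrite ncwordM. Qed.

Lemma ncC_star b : ncC (star b) = star (ncC b).
Proof.
apply: tens_ext => U F bF; rewrite [RHS]tlift_star // !tliftE //.
  by rewrite /weval !big_seq1.
exact: bal_wstar.
Qed.

Lemma ncCZD a b b' : ncC (a *: b + b') = a *: ncC b + ncC b'.
Proof.
apply: tens_ext => U F bF; rewrite tliftDr // tlift_scale //.
rewrite tliftE // [X in _ = X + _]tliftE; last exact: balZl.
by rewrite tliftE // /weval !big_seq1 (balDl bF).
Qed.

Lemma star1 : star (1 : B) = 1.
Proof. by rewrite -[LHS]mul1r -{1}[1](@starK C B) -starM mul1r starK. Qed.

Lemma ncX_star : star ncX = ncX.
Proof.
apply: tens_ext => U F bF; rewrite [LHS]tlift_star // !tliftE //.
  by rewrite /weval !big_seq1 /wstar /word_of /= star1.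
exact: bal_wstar.
Qed.

Lemma ncwordE b s : ncword (b, s) = ncC b * Xword s.
Proof.
have XwE t : Xword t = ncword (1, t).
  elim: t => [|c t IHt]; first by rewrite /Xword big_nil.
  rewrite /Xword big_cons -/(Xword t) IHt !ncwordM /nc_wmul /= mul1r.
  by rewrite mulr1.
by rewrite XwE ncwordM /nc_wmul /= mulr1.
Qed.

End NcPoly.

Section Maps.
Variables (R : realType) (B D : cstarAlgType R).

(* The entry of row j and column i is sigma (f_j^* f_i).  With the roles of rows
   and columns exchanged, no unital B-bimodule map has this property unless B
   is commutative: n = 2 and f = (1, b) would give b b^* <= b^* b for all b. *)
Definition propertyP (sigma : ncpoly B -> D) : Prop :=
  forall (n : nat) (f : 'I_n -> ncpoly B), (0 < n)%N ->
    psdmx (\matrix_(j < n, i < n) sigma (star (f j) * f i)).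

Definition propertyE (sigma : ncpoly B -> D) : Prop :=
  exists M : R, 0 < M /\ forall s : seq B,
    cnorm (sigma (ncX B * \prod_(b <- s) (ncC b * ncX B))) <=
      M ^+ (size s).+1 * \prod_(b <- s) cnorm b.

Definition bimodule_map (iota : B -> D) (mu : ncpoly B -> D) : Prop :=
  forall b f b', mu (ncC b * f * ncC b') = iota b * mu f * iota b'.

Record in_Sigma (iota : B -> D) (mu : ncpoly B -> D) : Prop := InSigma {
  Sigma_unital : mu 1 = 1;
  Sigma_bimodule : bimodule_map iota mu;
  Sigma_pos : forall f, exists d, mu (star f * f) = star d * d;
  Sigma_P : propertyP mu
}.

Definition in_Sigma0 (iota : B -> D) (mu : ncpoly B -> D) : Prop :=
  in_Sigma iota mu /\ propertyE mu.
End Maps.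

Section BooleanCumulants.
Variables (R : realType) (B D : cstarAlgType R).
Variables (iota : B -> D) (mu : ncpoly B -> D).

Fixpoint bcum_rec (k : nat) (s : seq B) : D :=
  if k is k'.+1 then
    mu (Xword s) -
    \sum_(1 <= j < size s) bcum_rec k' (take j s) * mu (Xword (drop j s))
  else 0.

(* B_{n, mu} (b1, ..., bn) = bcum [:: b1; ...; bn] *)
Definition bcum (s : seq B) : D := bcum_rec (size s) s.

Lemma bcum_recE k k' s : (0 < size s <= k)%N -> (size s <= k')%N ->
  bcum_rec k s = bcum_rec k' s.
Proof.
elim: k k' s => [|k IHk] [|k'] s /andP[s0 sk] sk'; try by case: (s) s0 sk sk'.
rewrite /=; congr (_ - _); apply: eq_big_nat => j /andP[j1 js].
congr (_ * _); apply: IHk; rewrite size_takel ?(ltnW js) // ?j1 /=.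
  by rewrite -ltnS (leq_trans js).
by rewrite -ltnS (leq_trans js).
Qed.

Lemma bcumE s : (0 < size s)%N ->
  bcum s = mu (Xword s) -
    \sum_(1 <= j < size s) bcum (take j s) * mu (Xword (drop j s)).
Proof.
rewrite /bcum; case: s => // c s _; rewrite [LHS]/=; congr (_ - _).
apply: eq_big_nat => j /andP[j1 js]; congr (_ * _).
have sj : size (take j (c :: s)) = j by rewrite size_takel // ltnW.
by apply: bcum_recE; rewrite sj // j1.
Qed.

Lemma boolean_recursion s : mu 1 = 1 -> (0 < size s)%N ->
  mu (Xword s) =
    \sum_(1 <= k < (size s).+1) bcum (take k s) * mu (Xword (drop k s)).
Proof.
move=> mu1 s0; rewrite big_nat_recr //= take_size drop_size.
by rewrite {3}/Xword big_nil mu1 mulr1 [bcum s]bcumE // addrC subrK.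
Qed.

(* beta_mu (b0 X b1 ... X bn) = b0 B_{n, mu} (b1, ..., bn), extended linearly;
   the form on words is balanced by [bal_boolean_word] below. *)
Definition boolean_word (w : tword B B) : D :=
  iota w.1 * (if w.2 is [::] then 1 else bcum w.2).
Definition boolean_beta (x : ncpoly B) : D := tlift boolean_word x.
End BooleanCumulants.

Section BooleanBetaTheory.
Variables (R : realType) (B D : cstarAlgType R).
Variables (iota : {lrmorphism B -> D}) (mu : {linear ncpoly B -> D}).
Hypothesis muS : in_Sigma iota mu.
Local Notation bcum := (bcum mu).
Local Notation boolean_word := (boolean_word iota mu).
Local Notation boolean_beta := (boolean_beta iota mu).

Lemma Xword_lin p (a : R[i]) (x y : B) q :
  Xword (p ++ (a *: x + y) :: q) =
  a *: Xword (p ++ x :: q) + Xword (p ++ y :: q).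
Proof.
rewrite /Xword !big_cat !big_cons /= ncCZD mulrDr mulrDl mulrDr.
by rewrite -!(scalerAr, scalerAl).
Qed.

Lemma bcum_lin p (a : R[i]) (x y : B) q :
  bcum (p ++ (a *: x + y) :: q) =
  a *: bcum (p ++ x :: q) + bcum (p ++ y :: q).
Proof.
have [n] := ubnP (size q); elim: n q => // n IHn q sq.
have s0 z : (0 < size (p ++ z :: q))%N by rewrite size_cat /= addnS.
rewrite !(bcumE mu (s0 _)) Xword_lin linearP scalerBr.
rewrite addrACA -opprD scaler_sumr; congr (_ - _).
have sz z : size (p ++ z :: q) = (size p + size q).+1.
  by rewrite size_cat /= addnS.
rewrite !sz -big_split /=; apply: eq_big_nat => j /andP[j1 js].
rewrite !take_cat !drop_cat; case: ltnP => [jp|].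
  by rewrite Xword_lin linearP mulrDr scalerAr.
rewrite leq_eqVlt => /predU1P[<-|pj].
  by rewrite subnn /= (Xword_lin [::]) linearP mulrDr scalerAr.
have -> : (j - size p = (j - size p).-1.+1)%N by rewrite prednK // subn_gt0.
rewrite /= IHn; first by rewrite mulrDl scalerAl.
rewrite size_take_min; apply: leq_trans (_ : (j - size p).-1.+1 <= n)%N.
  by rewrite ltnS geq_minl.
rewrite prednK ?subn_gt0 // leq_subLR.
by rewrite (leq_trans (_ : j <= size p + size q)%N) // leq_add2l -ltnS.
Qed.

Lemma bcum_rcons s (c b : B) :
  bcum (rcons s (c * b)) = bcum (rcons s c) * iota b.
Proof.
have XwM t : mu (Xword (rcons t (c * b))) = mu (Xword (rcons t c)) * iota b.
  rewrite /Xword -!cats1 !big_cat !big_seq1 /= ncCM !mulrA.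
  by rewrite -[in LHS](mul1r (_ * _ * ncC c)) -ncC1 (Sigma_bimodule muS) rmorph1 mul1r.
rewrite !bcumE ?size_rcons // XwM mulrBl mulr_suml; congr (_ - _).
apply: eq_big_nat => j /andP[_ js].
have ts z : take j (rcons s z) = take j s by rewrite -cats1 takel_cat.
have ds z : drop j (rcons s z) = rcons (drop j s) z by rewrite drop_rcons.
by rewrite !ts !ds XwM mulrA.
Qed.

Lemma boolean_wordE b s : (0 < size s)%N ->
  boolean_word (b, s) = iota b * bcum s.
Proof. by case: s. Qed.

Lemma bal_boolean_word : balanced boolean_word.
Proof.
have s0 (s : seq B) v s' : (0 < size (s ++ v :: s'))%N by rewrite size_cat /= addnS.
split=> [m m' s|m s v v' s'|a m s v s'].
- by rewrite /boolean_word /= rmorphD mulrDl.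
- rewrite !boolean_wordE // -[v in LHS]scale1r bcum_lin scale1r mulrDr //.
- rewrite !boolean_wordE // linearZ /= -scalerAl scalerAr; congr (_ * _).
  have h := bcum_lin s a v 0 s'; have h0 := bcum_lin s 1 0 0 s'.
  rewrite !scale1r addr0 in h0.
  have z : bcum (s ++ 0 :: s') = 0.
    by apply: (addrI (bcum (s ++ 0 :: s'))); rewrite -h0 addr0.
  by rewrite -[in RHS](addr0 (a *: v)) h z addr0.
Qed.

Lemma boolean_beta_linear : linear boolean_beta.
Proof.
move=> a x y; rewrite /boolean_beta tliftDr; last exact: bal_boolean_word.
rewrite tliftZ //; first exact: bal_boolean_word.
by move=> b m s; rewrite /boolean_word /= linearZ /= scalerAl.
Qed.

Lemma boolean_beta_unital : boolean_beta 1 = 1.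
Proof.
rewrite /boolean_beta tliftE; last exact: bal_boolean_word.
by rewrite /weval big_seq1 /boolean_word /= rmorph1 mulr1.
Qed.

Lemma boolean_beta_bimodule : bimodule_map iota boolean_beta.
Proof.
have bw := bal_boolean_word.
move=> b f b'; rewrite /boolean_beta tlift_mulw // tlift_wmul; last first.
  by case: (nc_wmulP bw (b', [::])).
rewrite /tlift mulr_sumr mulr_suml; apply: eq_bigr => -[m s] _.
rewrite /nc_wmul /=; case/lastP: s => [|s c] /=.
  by rewrite /boolean_word /= !mulr1 !rmorphM.
rewrite glue_rcons /= cats1 !boolean_wordE ?size_rcons //.
by rewrite bcum_rcons rmorphM !mulrA.
Qed.

Lemma boolean_beta_Xword s : (0 < size s)%N -> boolean_beta (Xword s) = bcum s.
Proof.
move=> s0; have -> : Xword s = ncword (1, s) by rewrite ncwordE ncC1 mul1r.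
rewrite /boolean_beta tliftE; last exact: bal_boolean_word.
by rewrite /weval big_seq1 boolean_wordE // rmorph1 mul1r.
Qed.
End BooleanBetaTheory.

Section NcFunctions.
Variables (R : realType) (B D : cstarAlgType R).

Definition Nilp n (b : 'M[B]_n) : Prop :=
  exists r : nat, (map_mx (@tens_in R[i] B) b) ^+ r = 0.

Definition Xb n (b : 'M[B]_n) : 'M[ncpoly B]_n :=
  (ncX B)%:M *m map_mx (@ncC _ B) b.

(* (1 - X b)^{-1}; the sum is over the k with (X b)^k != 0, and is meant for
   those b for which there are finitely many of them. *)
Definition resolvent n (b : 'M[B]_n) : 'M[ncpoly B]_n :=
  \sum_(k \in [set: nat]) Xb b ^+ k.

Definition Bfun (iota : B -> D) (mu : ncpoly B -> D) n (b : 'M[B]_n) : 'M[D]_n :=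
  map_mx (boolean_beta iota mu) (resolvent b) - 1%:M.
End NcFunctions.

(* Main.v *)
Require Import Defs.
From HB Require Import structures.
From mathcomp Require Import all_boot all_order all_algebra.
From mathcomp Require Import complex.
From mathcomp Require Import all_classical reals topology normedtype.
From mathcomp Require Import lra ring.
Import Order.TTheory GRing.Theory Num.Theory.
Import numFieldNormedType.Exports.
Local Open Scope ring_scope.

(** Let H be the right Hilbert D-module obtained from mu by the GNS
    construction, xi its vacuum vector, X the operator of multiplication by the
    variable, and Q the projection onto the orthogonal complement of xi D, which
    commutes with the left action of B.  Boolean cumulants are the moments of X
    in which the return to xi is forbidden:
      B_n (b1, ..., bn) = < xi, X b1 Q X b2 Q ... Q X bn xi >.
    Take alpha = mu X = B_1 1 and sigma f = beta (X f X), that is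
      sigma f = < Q X xi, f(Q X Q) (Q X xi) >,
    where f(Q X Q) is f with its variable replaced by Q X Q.  This is a vector
    functional, hence satisfies (P).  As B_n is right B-linear in its last
    argument, B_1 b = alpha b and the degree k + 2 term of B_mu at b is
    sigma (b (X b)^k) b; the identity holds term by term ([beta_Xb1],
    [beta_XbSS], [boolean_identity]).

    The covector  xi^* X b0 Q X b1 Q ... X bm Q  is a finite combination, with
    coefficients in D, of covectors xi^* g with g a polynomial, so the
    argument takes place among polynomials: [covector] lists the combination,
    and [covector_form_rcons] computes the inner product of two covectors as a
    value of sigma.  Hence
    sigma (f_j^* f_i) is the (j, i) entry of  e^* G e,  with e a rectangular
    matrix of coefficients and G a matrix of values mu (g_a^* g_b), which is
    c^* c by (P) for mu.

    That (c e)^* (c e) is also d^* d for a square matrix d is where C*-algebras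
    enter.  Kaplansky's theorem, that x^* x is the square of a selfadjoint
    element ([star_mul_sqr]), is proved from square roots of 1 - z with
    |z| <= 1, which exist by a monotone iteration; sums of such elements are
    then again of this form.  Applied to the entries, it gives the
    Cauchy-Schwarz inequality in the Hilbert module of columns, which makes
    the matrix algebra with its operator norm a C*-algebra; applied there, it
    gives [psdmx_gram].

    For the growth, (E) for mu and the recursion give |B_n| <= (2M)^n
    ([bcum_bound]), hence (E) for sigma.  Entrywise estimates of
    sigma (b (X b)^k) would depend on the size of b.  Instead, sigma carries its
    own form  sum_i sigma (F_i^* G_i)  on columns of polynomials.  There X is
    bounded by 2M, since the norms of X^m F are log-convex in m and grow at most
    like (2M)^m ([gns_norm_X]), and b is bounded by any r >= |b|, since
    r^2 - b^* b is some c^* c in the matrices over B ([gns_norm_mulC]).  So the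
    terms of the series are at most C (2 M r)^k, and r = 1 / (4M) serves for
    all sizes. *)

Set Implicit Arguments.
Unset Strict Implicit.
Unset Printing Implicit Defensive.
Local Open Scope complex_scope.

(** * Real sequences *)

Lemma cvg0P (R : realType) (u : nat -> R) : (forall n, 0 <= u n) ->
  (u @ \oo --> (0 : R))%classic <->
  (forall e, 0 < e -> exists N, forall n, (N <= n)%N -> u n < e).
Proof.
move=> u0; split.
  move=> /cvgrPdist_lt h e /h [N _ hN]; exists N => n /hN /=.
  by rewrite sub0r normrN ger0_norm.
move=> h; apply/cvgrPdist_lt => e /h [N hN]; exists N => // n /= /hN.
by rewrite sub0r normrN ger0_norm.
Qed.

Lemma bounded_nondecreasing_cauchy (R : realType) (t : nat -> R) M :
  (forall n, t n <= t n.+1) -> (forall n, t n <= M) ->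
  forall e, 0 < e -> exists N, forall m n, (N <= m)%N -> (N <= n)%N ->
     `|t m - t n| < e.
Proof.
move=> tS tM e e0; pose E : set R := range t.
have hE : has_sup E.
  split; first by exists (t 0%N); exists 0%N.
  by exists M => _ [n _ <-].
have [_ [N _ <-] hN] := sup_adherent e0 hE.
have mono : {homo t : m n / (m <= n)%N >-> m <= n}.
  by apply: homo_leq => //; exact: le_trans.
exists N => m n Nm Nn.
have ub k : t k <= sup E by apply: ub_le_sup; [case: hE|exists k].
have := mono _ _ Nm; have := mono _ _ Nn; have := ub m; have := ub n.
by rewrite ltr_norml; lra.
Qed.

Lemma cvg0_sum (R : realType) (I : Type) (s : seq I) (F : I -> nat -> R) :
  (forall i, (F i @ \oo --> (0 : R))%classic) ->
  ((fun k => \sum_(i <- s) F i k) @ \oo --> (0 : R))%classic.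
Proof.
move=> h; elim: s => [|i s IH].
  by under eq_fun do rewrite big_nil; exact: cvg_cst.
under eq_fun do rewrite big_cons.
by have := cvgD (h i) IH; rewrite addr0; apply.
Qed.

Lemma cvg0_shift2 (R : realType) (u : nat -> R) : (forall n, 0 <= u n) ->
  ((fun n => u n.+2) @ \oo --> (0 : R))%classic -> (u @ \oo --> (0 : R))%classic.
Proof.
move=> u0 /cvg0P h; apply/cvg0P => // e /h[//|N hN].
by exists N.+2 => -[|[|n]] // Nn; exact: hN.
Qed.

Lemma unbounded_exp (R : realType) (x c : R) : 1 < x -> exists m, c < x ^+ m.
Proof.
move=> x1; have bern m : 1 + (x - 1) *+ m <= x ^+ m.
  elim: m => [|m IH]; first by rewrite mulr0n addr0 expr0.
  rewrite exprS; apply: le_trans (ler_wpM2l (ltW (lt_trans ltr01 x1)) IH).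
  by have : 0 <= (x - 1) *+ m by [rewrite mulrn_wge0 ?subr_ge0 // ltW]; rewrite mulrS; nra.
pose k := Num.bound (`|c| / (x - 1)).
exists k; apply: lt_le_trans (bern k).
have xp : 0 < x - 1 by rewrite subr_gt0.
have := archi_boundP (divr_ge0 (normr_ge0 c) (ltW xp)); rewrite -/k ltr_pdivrMr //.
rewrite mulr_natl => h; apply: le_lt_trans (ler_norm c) _.
by rewrite ltr_wpDl.
Qed.

(** The successive ratios of a log-convex sequence increase, so a first ratio
    above K would make the sequence outgrow every multiple of K^m. *)
Lemma logconvex_growth (R : realType) (a : nat -> R) (C K : R) :
  (forall m, 0 <= a m) -> (forall m, a m.+1 ^+ 2 <= a m * a m.+2) ->
  0 < K -> (forall m, a m ^+ 2 <= C * (K ^+ 2) ^+ m) -> a 1%N <= K * a 0%N.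
Proof.
move=> a0 lc K0 aC; rewrite leNgt; apply/negP => h.
have a00 : 0 < a 0%N.
  rewrite lt_neqAle a0 andbT eq_sym; apply/eqP => z.
  by have := lc 0%N; rewrite z mul0r; move: h; rewrite z mulr0; nra.
pose q := a 1%N / a 0%N.
have qK : K < q by rewrite /q ltr_pdivlMr.
have q0 : 0 < q by exact: lt_trans qK.
have step m : 0 < a m /\ q * a m <= a m.+1.
  elim: m => [|m [am IH]]; first by rewrite /q mulfVK ?gt_eqF.
  have am1 : 0 < a m.+1 by apply: lt_le_trans IH; rewrite mulr_gt0.
  split=> //; rewrite -(ler_pM2l am); apply: le_trans (lc m).
  by rewrite expr2 mulrCA mulrA ler_wpM2r // ltW.
have low m : q ^+ m * a 0%N <= a m.
  elim: m => [|m IH]; first by rewrite expr0 mul1r.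
  by rewrite exprS -mulrA; apply: le_trans (step m).2; rewrite ler_wpM2l // ltW.
have [|m hm] := @unbounded_exp _ ((q / K) ^+ 2) (C / a 0%N ^+ 2).
  by rewrite exprn_egt1 // ltr_pdivlMr // mul1r.
move: hm; rewrite ltr_pdivrMr ?exprn_gt0 // => hm.
have := aC m; apply/negP; rewrite -ltNge.
apply: lt_le_trans (_ : (q ^+ m * a 0%N) ^+ 2 <= _); last first.
  by rewrite ler_pXn2r ?nnegrE ?mulr_ge0 ?exprn_ge0 // ltW.
rewrite -(ltr_pM2r (exprn_gt0 m (exprn_gt0 2 K0))) in hm.
apply: lt_le_trans hm _; rewrite le_eqVlt; apply/orP; left; apply/eqP.
rewrite mulrAC -exprMn -(exprMn _ (q / K)) divfK ?gt_eqF // [RHS]exprMn.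
by rewrite -!exprM mulnC.
Qed.

(** * Involutions and adjoint matrices *)

Section Involution.
Variables (C : numClosedFieldType) (A : starAlgType C).
Implicit Types x y : A.

Lemma star0 : star (0 : A) = 0.
Proof. by apply: (addrI (star 0)); rewrite -starD !addr0. Qed.

Lemma starN x : star (- x) = - star x.
Proof. by apply/eqP; rewrite -addr_eq0 -starD addNr star0. Qed.

Lemma starB x y : star (x - y) = star x - star y.
Proof. by rewrite starD starN. Qed.

Lemma star_sum (I : Type) (s : seq I) (P : pred I) (F : I -> A) :
  star (\sum_(i <- s | P i) F i) = \sum_(i <- s | P i) star (F i).
Proof. exact: (big_morph _ (@starD _ A) star0). Qed.

Lemma adjmxE m n (a : 'M[A]_(m, n)) i j : adjmx a i j = star (a j i).
Proof. by rewrite !mxE. Qed.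

Lemma adjmxK m n (a : 'M[A]_(m, n)) : adjmx (adjmx a) = a.
Proof. by apply/matrixP => i j; rewrite !mxE starK. Qed.

Lemma adjmxD m n (a b : 'M[A]_(m, n)) : adjmx (a + b) = adjmx a + adjmx b.
Proof. by apply/matrixP => i j; rewrite !mxE starD. Qed.

Lemma adjmxM m n p (a : 'M[A]_(m, n)) (b : 'M[A]_(n, p)) :
  adjmx (a *m b) = adjmx b *m adjmx a.
Proof.
apply/matrixP => i j; rewrite !mxE star_sum.
by apply: eq_bigr => k _; rewrite !mxE starM.
Qed.

End Involution.

(** * The norm of a C*-algebra *)

Section Norm.
Variables (R : realType) (A : cstarAlgType R).
Implicit Types (x y z : A) (r : R).

Lemma cnorm_scale r x : cnorm (r%:C *: x) = `|r| * cnorm x.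
Proof. by rewrite cnormZ /Normc.normc /= expr0n /= addr0 sqrtr_sqr. Qed.

Lemma star_scale r x : star (r%:C *: x) = r%:C *: star x.
Proof. by rewrite starZ; congr (_ *: _); exact: conjc_real. Qed.

Lemma cnorm0 : cnorm (0 : A) = 0.
Proof. by rewrite -(scale0r 0) -[0]/(0%:C) cnorm_scale normr0 mul0r. Qed.

Lemma cnormN x : cnorm (- x) = cnorm x.
Proof.
by rewrite -scaleN1r -(rmorph1 (real_complex R)) -rmorphN cnorm_scale normrN1 mul1r.
Qed.

Lemma cnorm_ge0 x : 0 <= cnorm x.
Proof.
have := cnormD x (- x); rewrite subrr cnorm0 cnormN -mulr2n.
by rewrite pmulrn_lge0.
Qed.

Lemma cnormB x y : cnorm (x - y) <= cnorm x + cnorm y.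
Proof. by rewrite -(cnormN y); apply: cnormD. Qed.

Lemma cnorm_distC x y : cnorm (x - y) = cnorm (y - x).
Proof. by rewrite -cnormN opprB. Qed.

Lemma cnorm_sum (I : Type) (s : seq I) (P : pred I) (F : I -> A) :
  cnorm (\sum_(i <- s | P i) F i) <= \sum_(i <- s | P i) cnorm (F i).
Proof.
elim/big_rec2: _ => [|i u v _ uv]; first by rewrite cnorm0.
by apply: le_trans (cnormD _ _) _; rewrite lerD2l.
Qed.

Lemma cnormMle x y a b : cnorm x <= a -> cnorm y <= b -> cnorm (x * y) <= a * b.
Proof.
by move=> xa yb; apply: le_trans (cnormM _ _) _; apply: ler_pM; rewrite ?cnorm_ge0.
Qed.

Lemma cnorm_star x : cnorm (star x) = cnorm x.
Proof.
have le u : cnorm (u : A) <= cnorm (star u).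
  have := cnorm_ge0 u; rewrite le_eqVlt => /predU1P[<-|u0].
    exact: cnorm_ge0.
  by rewrite -(ler_pM2r u0) -expr2 -cstar_identity cnormM.
by apply/eqP; rewrite eq_le (le x) -{2}(starK x) le.
Qed.

Lemma cstar_identityr x : cnorm (x * star x) = cnorm x ^+ 2.
Proof. by rewrite -[in LHS](starK x) starK -{1}(starK x) cstar_identity cnorm_star. Qed.

Lemma cnorm1 : cnorm (1 : A) <= 1.
Proof.
have := cnorm_ge0 (1 : A); rewrite le_eqVlt => /predU1P[<-|n0]; first exact: ler01.
have := cstar_identity (1 : A); rewrite star1 mulr1 expr2 -{1}(mulr1 (cnorm 1)).
by move/(mulfI (lt0r_neq0 n0)) => <-.
Qed.

Lemma cnorm_eq0_le x : cnorm x <= 0 -> x = 0.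
Proof. by move=> h; apply: cnorm0_eq0; apply/eqP; rewrite eq_le h cnorm_ge0. Qed.

Lemma star_mul_eq0 x : star x * x = 0 -> x = 0.
Proof.
move=> h; apply: cnorm0_eq0; apply/eqP; rewrite -sqrf_eq0 -cstar_identity h.
by rewrite cnorm0.
Qed.

(** Identities between limits are proved by estimating the difference of the
    two sides by a multiple of every positive e. *)
Lemma cnorm_small x c : (forall e, 0 < e -> cnorm x <= c * e) -> x = 0.
Proof.
move=> h; apply: cnorm_eq0_le; apply/ler_addgt0Pl => e e0; rewrite addr0.
have k0 : 0 < `|c| + 1 by rewrite ltr_wpDl.
apply: le_trans (h (e / (`|c| + 1)) _) _; first by rewrite divr_gt0.
rewrite mulrCA ler_piMr ?(ltW e0) // ler_pdivrMr // mul1r.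
by rewrite (le_trans (ler_norm c)) // lerDl.
Qed.

End Norm.

Lemma cnorm_limit (R : realType) (A : cstarAlgType R) (u : nat -> A) :
  (forall e : R, 0 < e -> exists N, forall m n, (N <= m)%N -> (N <= n)%N ->
     cnorm (u m - u n) < e) ->
  exists l, forall e, 0 < e -> exists N, forall n, (N <= n)%N -> cnorm (u n - l) < e.
Proof.
move=> /cnorm_complete [l hl]; exists l; apply/cvg0P => // n; exact: cnorm_ge0.
Qed.

Lemma geometric_series_cvg (R : realType) (A : cstarAlgType R) (u : nat -> A) (C : R) :
  (forall k, cnorm (u k) <= C * 2^-1 ^+ k) ->
  exists S, ((fun N => cnorm (\sum_(0 <= k < N) u k - S)) @ \oo --> (0 : R))%classic.
Proof.
move=> uC; apply: cnorm_complete => e e0.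
have C0 : 0 <= C by have := le_trans (cnorm_ge0 _) (uC 0%N); rewrite expr0 mulr1.
pose t N : R := 2 * C * (1 - 2^-1 ^+ N).
have tS n : t n + C * 2^-1 ^+ n = t n.+1 by rewrite /t exprS; field.
have p0 n : 0 <= C * 2^-1 ^+ n by rewrite mulr_ge0 ?exprn_ge0 ?invr_ge0.
have [||N hN] := @bounded_nondecreasing_cauchy _ t (2 * C) _ _ _ e0.
- by move=> n; rewrite -tS lerDl.
- by move=> n; have := p0 n; rewrite /t; lra.
have dist n k : cnorm (\sum_(0 <= i < n + k) u i - \sum_(0 <= i < n) u i) <= t (n + k)%N - t n.
  elim: k => [|k IH]; first by rewrite addn0 !subrr cnorm0.
  rewrite addnS big_nat_recr //= [X in cnorm X]addrAC -tS [leRHS]addrAC.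
  by apply: le_trans (cnormD _ _) _; apply: lerD IH (uC _).
exists N => m n.
wlog mn : m n / (n <= m)%N => [hw|] Nm Nn.
  by have /orP[|] := leq_total n m => h; [|rewrite cnorm_distC]; apply: hw.
rewrite -(subnKC mn); apply: le_lt_trans (dist _ _) _.
by apply: le_lt_trans (ler_norm _) _; apply: hN => //; rewrite subnKC.
Qed.

(** * Square roots *)

(** If s^2 = 1 - z then y = 1 - s satisfies 2 y = z + y^2.  This equation is
    solved by iteration from 0; the increments are dominated by those of the
    same iteration in the reals at z = 1, which increases and is bounded.  So
    the limit exists on the whole closed unit ball, and it inherits whatever is
    closed and true of polynomials in z. *)
Section Sqrt.
Variables (R : realType) (A : cstarAlgType R) (z : A).
Hypothesis z1 : cnorm z <= 1.

Fixpoint sqrt_iter n : A :=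
  if n is n'.+1 then (2^-1 : R)%:C *: (z + sqrt_iter n' * sqrt_iter n') else 0.
Fixpoint sqrt_bound n : R :=
  if n is n'.+1 then 2^-1 * (1 + sqrt_bound n' ^+ 2) else 0.
Local Notation y := sqrt_iter.
Local Notation t := sqrt_bound.

Lemma sqrt_bound01 n : 0 <= t n <= 1.
Proof. by elim: n => [|n] /=; rewrite ?lexx ?ler01 // => /andP[??]; nra. Qed.

Lemma sqrt_boundS n : t n <= t n.+1.
Proof. by rewrite /=; have := sqrt_bound01 n => /andP[? ?]; nra. Qed.

Lemma sqrt_iter_bound n : cnorm (y n) <= t n.
Proof.
elim: n => [|n IH] /=; first by rewrite cnorm0.
rewrite cnorm_scale ger0_norm ?invr_ge0 // ler_pM2l ?invr_gt0 //.
apply: le_trans (cnormD _ _) _; apply: lerD => //; rewrite expr2; exact: cnormMle.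
Qed.

Lemma sqrt_iter_comm x n : GRing.comm x z -> GRing.comm x (y n).
Proof.
move=> xz; elim: n => [|n IH] /=; first exact: commr0.
rewrite /GRing.comm -scalerAr -scalerAl; congr (_ *: _).
by apply: commrD => //; apply: commrM.
Qed.

(** The iterates commute, hence the difference of two squares factors. *)
Lemma sqrt_iterS n : cnorm (y n.+1 - y n) <= t n.+1 - t n.
Proof.
elim: n => [|n IH].
  rewrite /= subr0 mulr0 addr0 subr0 expr0n /= addr0 mulr1 cnorm_scale.
  by rewrite ger0_norm ?invr_ge0 // ler_piMr ?invr_ge0.
have -> : y n.+2 - y n.+1 =
    (2^-1 : R)%:C *: ((y n.+1 - y n) * (y n.+1 + y n)).
  rewrite [y n.+2]/= [X in _ - X]/= -scalerBr; congr (_ *: _).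
  have c : GRing.comm (y n) (y n.+1) by apply/sqrt_iter_comm/commr_sym/sqrt_iter_comm.
  by rewrite opprD addrACA subrr add0r mulrDl !mulrDr !mulNr c addrA addrK.
have -> : t n.+2 - t n.+1 = 2^-1 * ((t n.+1 - t n) * (t n.+1 + t n)).
  have tE k : t k.+1 = 2^-1 * (1 + t k ^+ 2) by [].
  by have := tE n; have := tE n.+1; lra.
rewrite cnorm_scale ger0_norm ?invr_ge0 // ler_pM2l ?invr_gt0 //.
apply: cnormMle => //; apply: le_trans (cnormD _ _) _.
by apply: lerD; exact: sqrt_iter_bound.
Qed.

Lemma sqrt_iter_dist n k : cnorm (y (n + k) - y n) <= t (n + k) - t n.
Proof.
elim: k => [|k IH]; first by rewrite addn0 !subrr cnorm0.
rewrite addnS -(subrKA (y (n + k)%N)) -[leRHS](subrKA (t (n + k)%N)).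
apply: le_trans (cnormD _ _) _; apply: lerD => //; exact: sqrt_iterS.
Qed.

Lemma sqrt_iter_limit : exists l, forall e, 0 < e -> exists n,
  cnorm (y n - l) < e /\ cnorm (y n.+1 - l) < e.
Proof.
have [|l hl] := @cnorm_limit R A y.
  move=> e e0.
  have t1 n : t n <= 1 by have /andP[] := sqrt_bound01 n.
  have [N hN] := bounded_nondecreasing_cauchy sqrt_boundS t1 e0.
  exists N => m n.
  wlog mn : m n / (n <= m)%N => [hw|] Nm Nn.
    by have /orP[|] := leq_total n m => h; [|rewrite cnorm_distC]; apply: hw.
  rewrite -(subnKC mn); apply: le_lt_trans (sqrt_iter_dist _ _) _.
  apply: le_lt_trans (ler_norm _) _; apply: hN => //.
  by rewrite subnKC.
exists l => e /hl[N hN]; exists N; split; apply: hN => //.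
Qed.

Lemma cnorm_sqrt : exists s : A,
  [/\ s * s = 1 - z, cnorm (1 - s) <= 1, (star z = z -> star s = s) &
      forall x, GRing.comm x z -> GRing.comm x s].
Proof.
have [l hl] := sqrt_iter_limit.
have y1 n : cnorm (y n) <= 1.
  by apply: le_trans (sqrt_iter_bound n) _; have /andP[] := sqrt_bound01 n.
have l1 : cnorm l <= 1.
  apply/ler_addgt0Pl => e /hl[n [h _]]; rewrite -(subrK (y n) l).
  apply: le_trans (cnormD _ _) _; apply: lerD => //.
  by rewrite cnorm_distC ltW.
have cl x : GRing.comm x z -> GRing.comm x l.
  move=> /sqrt_iter_comm xy; apply/eqP; rewrite -subr_eq0; apply/eqP.
  apply: (@cnorm_small _ _ _ (2 * cnorm x)) => e /hl[n [/ltW h _]].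
  have -> : x * l - l * x = x * (l - y n) - (l - y n) * x.
    by rewrite mulrBr mulrBl (xy n) opprB addrA addrNK.
  apply: le_trans (cnormB _ _) _; rewrite -mulrA mulr_natl mulr2n.
  rewrite cnorm_distC in h.
  by apply: lerD; [|rewrite mulrC]; apply: cnormMle.
have sqr_l : l + l = z + l * l.
  apply/eqP; rewrite -subr_eq0; apply/eqP.
  apply: (@cnorm_small _ _ _ 4) => e /hl[n [/ltW h /ltW h1]].
  have eqy : y n.+1 + y n.+1 = z + y n * y n.
    by rewrite /= -scalerDl -rmorphD -div1r -splitr scale1r.
  have -> : l + l - (z + l * l) = ((l - y n.+1) + (l - y n.+1))
     + ((y n - l) * y n + l * (y n - l)).
    rewrite mulrBl mulrBr subrKA (addrACA l) -opprD eqy !opprD !addrA.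
    by rewrite subrK.
  rewrite cnorm_distC in h1.
  have -> : 4 * e = (e + e) + (e * 1 + 1 * e) by ring.
  apply: le_trans (cnormD _ _) _; apply: lerD; apply: le_trans (cnormD _ _) _;
    apply: lerD => //; exact: cnormMle.
exists (1 - l); split.
- have -> : z = l + l - l * l by rewrite sqr_l addrK.
  by rewrite mulrBl mul1r mulrBr mulr1 !opprB opprD -!addrA; congr (_ + _); rewrite addrCA.
- by rewrite opprB addrC subrK.
- move=> sz; have sy n : star (y n) = y n.
    by elim: n => [|n IH] /=; rewrite ?star0 // star_scale starD starM IH sz.
  rewrite starB star1; congr (_ - _); apply/eqP; rewrite -subr_eq0; apply/eqP.
  apply: (@cnorm_small _ _ _ 2) => e /hl[n [/ltW h _]].
  rewrite -(subrKA (y n)); apply: le_trans (cnormD _ _) _.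
  rewrite mulr_natl mulr2n; apply: lerD => //.
  by rewrite -{1}(sy n) -starB cnorm_star cnorm_distC.
- by move=> x /cl xl; apply: commrB => //; exact: commr1.
Qed.

End Sqrt.

(** * Positive elements *)

Section Positivity.
Variables (R : realType) (A : cstarAlgType R).
Implicit Types (x y z h k g s : A) (r : R).

(** Positivity; being c^* c for some c is equivalent only after
    [star_mul_sqr], and this form is the one stable under sums by elementary
    means. *)
Definition selfadj_sqr (a : A) : Prop := exists h, star h = h /\ a = h * h.

Lemma scale_sqr r x : (r%:C *: x) * (r%:C *: x) = (r ^+ 2)%:C *: (x * x).
Proof. by rewrite -scalerAl -scalerAr scalerA -rmorphM -expr2. Qed.

Lemma star_scale_i x : star ('i%R *: x) = - ('i%R *: star x).
Proof. by rewrite starZ conjCi scaleNr. Qed.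

Lemma mul_scale_i x y : ('i%R *: x) * ('i%R *: y) = - (x * y).
Proof. by rewrite -scalerAl -scalerAr scalerA -expr2 sqrCi scaleN1r. Qed.

Lemma cnorm_double x : cnorm (x + x) = 2 * cnorm x.
Proof.
by rewrite -mulr2n -scaler_nat -(rmorph_nat (real_complex R)) cnorm_scale normr_nat.
Qed.

Lemma scale_half x : (2^-1 : R)%:C *: (x + x) = x.
Proof. by rewrite scalerDr -scalerDl -rmorphD -div1r -splitr scale1r. Qed.

Lemma cnorm_selfadj_sqr h : star h = h -> cnorm (h * h) = cnorm h ^+ 2.
Proof. by move=> hh; rewrite -{1}hh cstar_identity. Qed.

(** h + i k is unitary, and h is the real part of it. *)
Lemma circle_le1 h k : star h = h -> star k = k -> GRing.comm h k ->
  h * h + k * k = 1 -> cnorm h <= 1.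
Proof.
move=> hh kk hk e; pose u := h + 'i%R *: k.
have su : star u = h - 'i%R *: k by rewrite starD star_scale_i hh kk.
have u1 : cnorm u <= 1.
  rewrite -(@expr_le1 _ 2) ?cnorm_ge0 // -cstar_identity su /u.
  rewrite mulrBl !mulrDr mul_scale_i -scalerAr -scalerAl hk.
  by rewrite opprD opprK addrA addrK e cnorm1.
have : 2 * cnorm h <= 1 + 1.
  rewrite -cnorm_double; have -> : h + h = star u + u.
    by rewrite su /u addrACA addNr addr0.
  by apply: le_trans (cnormD _ _) _; rewrite cnorm_star lerD.
by lra.
Qed.

(** The square root of 1 - h^2 commutes with h, so the two lie on a circle. *)
Lemma sqrt_complement h : star h = h -> cnorm h <= 1 -> exists k,
  [/\ star k = k, k * k = 1 - h * h, cnorm k <= 1 &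
      forall x, GRing.comm x (h * h) -> GRing.comm x k].
Proof.
move=> hh h1; have hh1 : cnorm (h * h) <= 1 by rewrite -(mul1r 1); apply: cnormMle.
have [k [kk _ sk ck]] := cnorm_sqrt hh1.
have {}sk : star k = k by apply: sk; rewrite starM hh.
exists k; split=> //; apply: (@circle_le1 k h) => //.
  by apply/commr_sym/ck; apply: commrM.
by rewrite kk subrK.
Qed.

Lemma selfadj_sqr_near1 a : star a = a -> cnorm (1 - a) <= 1 -> exists s,
  [/\ star s = s, s * s = a & forall x, GRing.comm x a -> GRing.comm x s].
Proof.
move=> sa a1; have [s [ss _ hs cs]] := cnorm_sqrt a1.
exists s; split.
- by apply: hs; rewrite starB star1 sa.
- by rewrite ss opprB addrC subrK.
- by move=> x xa; apply: cs; apply: commrB => //; exact: commr1.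
Qed.

Lemma selfadj_sqr_dist1 h : star h = h -> cnorm h <= 1 -> cnorm (1 - h * h) <= 1.
Proof.
move=> hh h1; have [k [_ <- k1 _]] := sqrt_complement hh h1.
by rewrite -(mul1r 1); apply: cnormMle.
Qed.

Lemma selfadj_sqrZ r a : 0 <= r -> selfadj_sqr a -> selfadj_sqr (r%:C *: a).
Proof.
move=> r0 [h [hh ->]]; exists ((Num.sqrt r)%:C *: h); split.
  by rewrite star_scale hh.
by rewrite scale_sqr sqr_sqrtr.
Qed.

Lemma scaleVK r x : r != 0 -> r%:C *: (r^-1%:C *: x) = x.
Proof. by move=> r0; rewrite scalerA -rmorphM divff // scale1r. Qed.

Lemma cnorm_scaleV r x : 0 < r -> cnorm x <= r -> cnorm (r^-1%:C *: x) <= 1.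
Proof.
move=> r0 xr; rewrite cnorm_scale gtr0_norm ?invr_gt0 //.
by rewrite mulrC ler_pdivrMr // mul1r.
Qed.

(** A selfadjoint a with |1 - a| <= 1 is a square, and a square of norm at most
    1 satisfies this inequality, which is convex in a. *)
Lemma selfadj_sqrD a b : selfadj_sqr a -> selfadj_sqr b -> selfadj_sqr (a + b).
Proof.
move=> [h [hh ->]] [k [kk ->]].
pose r := 1 + cnorm h + cnorm k.
have h0 := cnorm_ge0 h; have k0 := cnorm_ge0 k.
have r0 : 0 < r by rewrite /r; lra.
pose h' := r^-1%:C *: h; pose k' := r^-1%:C *: k.
have hh' : star h' = h' by rewrite star_scale hh.
have kk' : star k' = k' by rewrite star_scale kk.
have h1 : cnorm h' <= 1 by apply: cnorm_scaleV => //; rewrite /r; lra.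
have k1 : cnorm k' <= 1 by apply: cnorm_scaleV => //; rewrite /r; lra.
pose c := (2^-1 : R)%:C *: (h' * h' + k' * k').
have [||s [ss sc _]] := @selfadj_sqr_near1 c.
- by rewrite /c star_scale starD !starM hh' kk'.
- have -> : 1 - c = (2^-1 : R)%:C *: ((1 - h' * h') + (1 - k' * k')).
    rewrite addrACA -opprD scalerBr -/c; congr (_ - _).
    by rewrite scale_half.
  rewrite cnorm_scale ger0_norm ?invr_ge0 // mulrC ler_pdivrMr // mul1r.
  apply: le_trans (cnormD _ _) _; rewrite -[leRHS]/(1 + 1).
  by apply: lerD; exact: selfadj_sqr_dist1.
have -> : h * h + k * k = (r ^+ 2)%:C *: ((2 : R)%:C *: c).
  rewrite scaleVK ?pnatr_eq0 // /h' /k' !scale_sqr -scalerDr scalerA -rmorphM.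
  by rewrite -exprMn divff ?gt_eqF // expr1n scale1r.
apply: selfadj_sqrZ; first exact: sqr_ge0.
by apply: selfadj_sqrZ; [exact: ler0n | exists s].
Qed.

(** The root of b need not commute with h, but b = 1 - h^2 does, and
    [selfadj_sqr_near1] provides another root of b commuting with h. *)
Lemma selfadj_sqr_le1 h b : star h = h -> selfadj_sqr b -> h * h + b = 1 ->
  cnorm h <= 1.
Proof.
move=> hh [k [kk ->]] e; pose r := 1 + cnorm k.
have k0 := cnorm_ge0 k.
have r0 : 0 < r by rewrite /r; lra.
pose k' := r^-1%:C *: k.
have kk' : star k' = k' by rewrite star_scale kk.
have k1 : cnorm k' <= 1 by apply: cnorm_scaleV => //; rewrite /r; lra.
have [|j [jj j2 cj]] := selfadj_sqr_near1 _ (selfadj_sqr_dist1 kk' k1).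
  by rewrite starM kk'.
apply: (@circle_le1 _ (r%:C *: j)) => //.
- by rewrite star_scale jj.
- rewrite /GRing.comm -scalerAr -scalerAl; congr (_ *: _); apply: cj.
  have -> : k' * k' = (r^-1 ^+ 2)%:C *: (1 - h * h).
    by rewrite scale_sqr -e [_ + k * k]addrC addrK.
  rewrite /GRing.comm -scalerAr -scalerAl; congr (_ *: _).
  by apply: commrB; [exact: commr1|apply: commrM].
- by rewrite scale_sqr j2 /k' -scale_sqr scaleVK ?gt_eqF.
Qed.

(** Monotonicity of the norm: after division by any r > |g|, the element 1 - g^2
    is a square, and adding it to both sides gives [selfadj_sqr_le1]. *)
Lemma selfadj_sqr_le h b g : star h = h -> star g = g -> selfadj_sqr b ->
  h * h + b = g * g -> cnorm h <= cnorm g.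
Proof.
move=> hh gg sb e; apply/ler_addgt0Pl => d d0; rewrite addrC; set r := _ + _.
have g0 := cnorm_ge0 g.
have r0 : 0 < r by rewrite /r; lra.
have g1 : cnorm (r^-1%:C *: g) <= 1 by apply: cnorm_scaleV => //; rewrite /r; lra.
have [|k [kk k2 _ _]] := @sqrt_complement (r^-1%:C *: g) _ g1.
  by rewrite star_scale gg.
have : cnorm (r^-1%:C *: h) <= 1.
  apply: (@selfadj_sqr_le1 _ ((r^-1 ^+ 2)%:C *: b + k * k)).
  - by rewrite star_scale hh.
  - by apply: selfadj_sqrD; [apply: selfadj_sqrZ; rewrite ?sqr_ge0|exists k].
  - by rewrite k2 !scale_sqr addrA -scalerDr e [_ + (1 - _)]addrC subrK.
by rewrite cnorm_scale gtr0_norm ?invr_gt0 // mulrC ler_pdivrMr // mul1r.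
Qed.

(** y^* y + y y^* is twice the sum of the squares of the real and imaginary
    parts of y, so y y^* is a sum of squares when y^* y is the opposite of one. *)
Lemma star_mul_anti_sqr y w : star w = w -> star y * y = - (w * w) ->
  selfadj_sqr (y * star y).
Proof.
move=> ww e.
pose p := y + star y; pose q := 'i%R *: (y - star y).
have sp : star p = p by rewrite starD starK addrC.
have sq : star q = q by rewrite star_scale_i starB starK -scalerN opprB.
have -> : y * star y = (2^-1 : R)%:C *: (p * p + q * q + (w * w + w * w)).
  have -> : w * w + w * w = - (star y * y + star y * y).
    by rewrite e opprD opprK.
  have -> : p * p + q * q = (y * star y + y * star y) + (star y * y + star y * y).
    have -> : q * q = (y * star y - y * y) + (star y * y - star y * star y).
      by rewrite mul_scale_i mulrBl opprB !mulrBr opprB addrC.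
    have -> : p * p = (y * star y + y * y) + (star y * y + star y * star y).
      by rewrite /p mulrDl !mulrDr [y * y + _]addrC.
    by rewrite addrACA; congr (_ + _); rewrite addrACA subrr addr0.
  by rewrite addrK scale_half.
by apply: selfadj_sqrZ; rewrite ?invr_ge0 //; do 2!apply: selfadj_sqrD;
  [exists p|exists q|exists w|exists w].
Qed.

(** With v^2 = y y^* one has v^2 + v^4 = y (1 - w^2) y^*, of norm at most 1,
    whereas v^2 + v^4 = 2 v^4 + v^2 (1 - v^2) dominates 2 v^4, of norm 2. *)
Lemma star_mul_anti_sqr_norm1 y w : star w = w -> star y * y = - (w * w) ->
  cnorm y <> 1.
Proof.
move=> ww e y1; have [v [vv v2]] := star_mul_anti_sqr ww e.
have v1 : cnorm v ^+ 2 = 1 by rewrite -cnorm_selfadj_sqr // -v2 cstar_identityr y1 expr1n.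
have w1 : cnorm w <= 1.
  rewrite -(@expr_le1 _ 2) ?cnorm_ge0 // -cnorm_selfadj_sqr // -cnormN -e.
  by rewrite cstar_identity y1 expr1n.
have vle1 : cnorm v <= 1 by rewrite -(@expr_le1 _ 2) ?cnorm_ge0 // v1.
have svv : star (v * v) = v * v by rewrite starM vv.
have [||g [gg g2]] := @selfadj_sqrD (v * v) (v * v * (v * v)).
- by exists v.
- by exists (v * v).
have g1 : cnorm g <= 1.
  rewrite -(@expr_le1 _ 2) ?cnorm_ge0 // -cnorm_selfadj_sqr // -g2 -v2.
  have -> : y * star y + y * star y * (y * star y) = y * (1 - w * w) * star y.
    by rewrite -e mulrDr mulrDl mulr1 !mulrA.
  apply: le_trans (cnormMle (cnormMle (lexx _) (selfadj_sqr_dist1 ww w1)) (lexx _)) _.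
  by rewrite cnorm_star y1 !mulr1.
(* v^2 (1 - v^2) = (v k)^2, since k commutes with v. *)
have [k [kk k2 _ ck]] := sqrt_complement vv vle1.
have vk : v * k = k * v by apply: ck; apply: commrM.
have : cnorm ((Num.sqrt (2 : R))%:C *: (v * v)) <= cnorm g.
  apply: (@selfadj_sqr_le _ (v * k * (v * k))) => //.
  - by rewrite star_scale svv.
  - by exists (v * k); split=> //; rewrite starM vv kk vk.
  - have -> : v * k * (v * k) = v * v - v * v * (v * v).
      rewrite -[X in X - _]mulr1 -mulrBr -k2 !mulrA; congr (_ * _).
      by rewrite -mulrA -vk mulrA.
    rewrite scale_sqr sqr_sqrtr // -g2 (rmorph_nat (real_complex R)) scaler_nat.
    by rewrite mulr2n addrC addrA subrK.
rewrite cnorm_scale cnorm_selfadj_sqr // v1 mulr1 ger0_norm ?sqrtr_ge0 //.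
move=> /le_trans/(_ g1); apply/negP; rewrite -ltNge -[ltLHS]sqrtr1.
by rewrite ltr_sqrt ?ltr1n.
Qed.

Lemma star_mul_anti_sqr_eq0 y w : star w = w -> star y * y = - (w * w) -> y = 0.
Proof.
move=> ww e; apply/cnorm0_eq0/eqP/negPn/negP => y0.
have {}y0 : 0 < cnorm y by rewrite lt_neqAle eq_sym y0 cnorm_ge0.
pose r := (cnorm y)^-1.
apply: (@star_mul_anti_sqr_norm1 (r%:C *: y) (r%:C *: w)).
- by rewrite star_scale ww.
- rewrite star_scale scale_sqr -scalerN -e.
  by rewrite -scalerAl -scalerAr scalerA -rmorphM -expr2.
- by rewrite cnorm_scale gtr0_norm ?invr_gt0 // /r mulVf // gt_eqF.
Qed.

(** Let a = x^* x, m = |a| the root of a^2 and s the root of m.  Then m - a is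
    twice the negative part of a, and y = x (m - a) satisfies
    y^* y = - (s (m - a))^2; hence y = 0, which forces m = a. *)
Lemma star_mul_sqr_le1 x : cnorm x <= 1 -> selfadj_sqr (star x * x).
Proof.
move=> x1; set a := star x * x.
have sa : star a = a by rewrite starM starK.
have a1 : cnorm a <= 1 by rewrite -(mul1r 1); apply: cnormMle; rewrite ?cnorm_star.
have [m [m2 m1 sm cm]] := cnorm_sqrt (selfadj_sqr_dist1 sa a1).
have {}m2 : m * m = a * a by rewrite m2 opprB addrC subrK.
have {}sm : star m = m by apply: sm; rewrite starB star1 starM sa.
have am : a * m = m * a.
  by apply: cm; apply: commrB; [exact: commr1|apply: commrM].
have [s [ss s2 cs]] := selfadj_sqr_near1 sm m1.
have sms : s * m = m * s by rewrite -s2 mulrA.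
have sas : a * s = s * a by exact: cs.
have sma : star (m - a) = m - a by rewrite starB sm sa.
have csd : s * (m - a) = (m - a) * s by rewrite mulrBl mulrBr sms sas.
have cad : a * (m - a) = (m - a) * a by rewrite mulrBl mulrBr am.
have cmd : m * (m - a) = (m - a) * m by rewrite mulrBl mulrBr am.
have amd : a * (m - a) = - (m * (m - a)).
  by rewrite !mulrBr am m2 opprB.
have w0 : x * (m - a) = 0.
  apply: (@star_mul_anti_sqr_eq0 _ (s * (m - a))).
    by rewrite starM sma ss csd.
  rewrite starM sma mulrA -[_ * star x * x]mulrA -/a -cad amd mulNr; congr (- _).
  by rewrite {1}csd mulrA -[_ * s * s]mulrA s2 cmd.
have md0 : m * (m - a) = 0.
  by rewrite -[LHS]opprK -amd /a -mulrA w0 mulr0 oppr0.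
have ma : m = a.
  apply/eqP; rewrite -subr_eq0; apply/eqP; apply: star_mul_eq0.
  by rewrite sma mulrBl amd md0 !oppr0 addr0.
by exists s; split=> //; rewrite -ma.
Qed.

(** Kaplansky's theorem. *)
Lemma star_mul_sqr x : selfadj_sqr (star x * x).
Proof.
pose r := 1 + cnorm x; have x0 := cnorm_ge0 x.
have r0 : 0 < r by rewrite /r; lra.
have x1 : cnorm (r^-1%:C *: x) <= 1 by apply: cnorm_scaleV => //; rewrite /r; lra.
have -> : star x * x = (r ^+ 2)%:C *: (star (r^-1%:C *: x) * (r^-1%:C *: x)).
  rewrite star_scale -scalerAl -scalerAr !scalerA -!rmorphM -mulrA -expr2.
  by rewrite -exprMn divff ?gt_eqF // expr1n scale1r.
by apply: selfadj_sqrZ; rewrite ?sqr_ge0 //; exact: star_mul_sqr_le1.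
Qed.

Lemma star_mulD x y : exists z, star x * x + star y * y = star z * z.
Proof.
have [z [zz ->]] := selfadj_sqrD (star_mul_sqr x) (star_mul_sqr y).
by exists z; rewrite zz.
Qed.

Lemma star_mul_sum (I : Type) (s : seq I) (P : pred I) (F : I -> A) :
  exists z, \sum_(i <- s | P i) star (F i) * F i = star z * z.
Proof.
elim/big_rec: _ => [|i _ _ [z ->]]; first by exists 0; rewrite mulr0.
exact: star_mulD.
Qed.

Lemma star_mul_le x y z : star x * x + star y * y = star z * z ->
  cnorm x <= cnorm z.
Proof.
have [h [hh ex]] := star_mul_sqr x; have [g [gg eg]] := star_mul_sqr z.
rewrite ex eg => /(selfadj_sqr_le hh gg (star_mul_sqr y)) hg.
rewrite -(@ler_pXn2r _ 2) ?nnegrE ?cnorm_ge0 // -!cstar_identity ex eg.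
by rewrite !cnorm_selfadj_sqr // ler_pXn2r ?nnegrE ?cnorm_ge0.
Qed.

Lemma star_mul_complement x r : 0 < r -> cnorm x <= r ->
  exists c, (r ^+ 2)%:C *: 1 - star x * x = star c * c.
Proof.
move=> r0 xr; have [h [hh ex]] := star_mul_sqr x.
have hr : cnorm (r^-1%:C *: h) <= 1.
  apply: cnorm_scaleV => //; rewrite -(@ler_pXn2r _ 2) ?nnegrE ?cnorm_ge0 ?(ltW r0) //.
  rewrite -cnorm_selfadj_sqr // -ex cstar_identity.
  by rewrite ler_pXn2r ?nnegrE ?cnorm_ge0 ?(ltW r0).
have [|k [kk k2 _ _]] := sqrt_complement _ hr; first by rewrite star_scale hh.
exists (r%:C *: k); rewrite star_scale kk scale_sqr k2 scalerBr scale_sqr.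
by rewrite scalerA -rmorphM -exprMn divff ?gt_eqF // expr1n scale1r ex.
Qed.

End Positivity.

(** * The Hilbert module of columns *)

Section HilbertModule.
Variables (R : realType) (A : cstarAlgType R) (n : nat).
Implicit Types (x y : 'cV[A]_n) (d : A) (r : R).

Definition col_ip x y : A := (adjmx x *m y) 0 0.

Lemma col_ipE x y : col_ip x y = \sum_i star (x i 0) * y i 0.
Proof. by rewrite /col_ip mxE; apply: eq_bigr => i _; rewrite adjmxE. Qed.

Lemma star_col_ip x y : star (col_ip x y) = col_ip y x.
Proof. by rewrite /col_ip -adjmxE adjmxM adjmxK. Qed.

Lemma col_ipDr x y z : col_ip x (y + z) = col_ip x y + col_ip x z.
Proof. by rewrite /col_ip mulmxDr mxE. Qed.

Lemma col_ipDl x y z : col_ip (x + y) z = col_ip x z + col_ip y z.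
Proof. by rewrite /col_ip adjmxD mulmxDl mxE. Qed.

Lemma mulmx_scalarE y d i : (y *m d%:M) i 0 = y i 0 * d.
Proof. by rewrite mxE big_ord1 mxE eqxx mulr1n. Qed.

Lemma col_ip_mulr x y d : col_ip x (y *m d%:M) = col_ip x y * d.
Proof.
by rewrite !col_ipE mulr_suml; apply: eq_bigr => i _; rewrite mulmx_scalarE mulrA.
Qed.

Lemma col_ip_mull x y d : col_ip (x *m d%:M) y = star d * col_ip x y.
Proof. by rewrite -star_col_ip col_ip_mulr starM star_col_ip. Qed.

Lemma col_ip_adj (a : 'M[A]_n) x y : col_ip (a *m x) y = col_ip x (adjmx a *m y).
Proof. by rewrite /col_ip adjmxM mulmxA. Qed.

Lemma col_ip_sqr x : exists z, col_ip x x = star z * z.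
Proof. by rewrite col_ipE; exact: star_mul_sum. Qed.

Lemma colnormE x : colnorm x = Num.sqrt (cnorm (col_ip x x)).
Proof. by rewrite col_ipE. Qed.

Lemma colnorm_ge0 x : 0 <= colnorm x.
Proof. exact: sqrtr_ge0. Qed.

Lemma colnorm_sqr x : colnorm x ^+ 2 = cnorm (col_ip x x).
Proof. by rewrite colnormE sqr_sqrtr // cnorm_ge0. Qed.

Lemma colnorm_root x z : col_ip x x = star z * z -> colnorm x = cnorm z.
Proof.
by move=> e; rewrite colnormE e cstar_identity sqrtr_sqr ger0_norm ?cnorm_ge0.
Qed.

(** For r >= |x|, expand the square of r^2 y - x d with d = <x, y>: the term
    d^* <x, x> d is at most r^2 d^* d, because r^2 - <x, x> is some c^* c.  This
    leaves r^2 d^* d <= r^4 <y, y>; the extra factors r avoid dividing by |x|. *)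
Lemma cauchy_schwarz x y : cnorm (col_ip x y) <= colnorm x * colnorm y.
Proof.
have [z ez] := col_ip_sqr x; have [w ew] := col_ip_sqr y.
rewrite (colnorm_root ez) (colnorm_root ew); set d := col_ip x y.
(* If z = 0 there is no r = |z| to divide by, and r is let go to 0 instead. *)
have key r : 0 < r -> cnorm z <= r -> cnorm d <= r * cnorm w.
  move=> r0 zr; have [c ec] := star_mul_complement r0 zr.
  pose v := y *m ((r ^+ 2)%:C *: 1)%:M + x *m (- d)%:M.
  have [s es] := col_ip_sqr v.
  have [p ep] := star_mulD s (c * d).
  rewrite -(ler_pM2l r0) mulrA -expr2 -[r in leLHS]gtr0_norm // -cnorm_scale.
  rewrite -[r ^+ 2]ger0_norm ?sqr_ge0 // -cnorm_scale.
  apply: (@star_mul_le _ _ _ p).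
  rewrite -ep -es /v col_ipDl !col_ipDr !col_ip_mull !col_ip_mulr -/d ez ew.
  rewrite -[col_ip y x]star_col_ip -/d !starN !star_scale star1 starM.
  rewrite [star d * star c * _]mulrA -(mulrA (star d) (star c)) -ec.
  rewrite !(mulrDr, mulrDl, mulrBr, mulrBl, mulrN, mulNr, opprK).
  rewrite -!(scalerAl, scalerAr) !mulr1 !mul1r !mulrA.
  rewrite scalerA -rmorphM -expr2.
  have cancel (a b e : A) : a + (b - a + (- a + e) + (a - e)) = b.
    by rewrite -(addrA (b - a)) -[a - e]opprB [e - a]addrC subrr addr0 addrC subrK.
  exact: cancel.
have := cnorm_ge0 z; rewrite le_eqVlt => /predU1P[z0|z0]; last exact: key.
rewrite -z0 mul0r (_ : d = 0) ?cnorm0 //.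
by apply: (@cnorm_small _ _ _ (cnorm w)) => e e0; rewrite mulrC key // -z0 ltW.
Qed.

Lemma colnormD x y : colnorm (x + y) <= colnorm x + colnorm y.
Proof.
rewrite -(@ler_pXn2r _ 2) ?nnegrE ?addr_ge0 ?colnorm_ge0 // colnorm_sqr.
rewrite col_ipDl !col_ipDr sqrrD !colnorm_sqr.
have xy := cauchy_schwarz x y; have yx := cauchy_schwarz y x.
have := cnormD (col_ip x x + col_ip x y) (col_ip y x + col_ip y y).
have := cnormD (col_ip x x) (col_ip x y); have := cnormD (col_ip y x) (col_ip y y).
by move: xy yx; set p := colnorm x; set q := colnorm y; lra.
Qed.

Lemma cnorm_entry_le x i : cnorm (x i 0) <= colnorm x.
Proof.
have [z ez] := col_ip_sqr x; rewrite (colnorm_root ez).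
have [w ew] := star_mul_sum (index_enum 'I_n) (fun j => j != i) (fun j => x j 0).
by apply: (@star_mul_le _ _ _ w); rewrite -ez col_ipE (bigD1 i) //= ew.
Qed.

Lemma colnorm_eq0 x : colnorm x = 0 -> x = 0.
Proof.
move=> x0; apply/matrixP => i j; rewrite ord1 mxE.
by apply: cnorm_eq0_le; rewrite -x0 cnorm_entry_le.
Qed.

Lemma colnorm_le_sum x : colnorm x <= \sum_i cnorm (x i 0).
Proof.
rewrite -(@ler_pXn2r _ 2) ?nnegrE ?colnorm_ge0 ?sumr_ge0 // => [|i _]; last first.
  exact: cnorm_ge0.
rewrite colnorm_sqr col_ipE; apply: le_trans (cnorm_sum _ _ _) _.
under eq_bigr do rewrite cstar_identity.
suff [] : \sum_i cnorm (x i 0) ^+ 2 <= (\sum_i cnorm (x i 0)) ^+ 2 /\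
    0 <= \sum_i cnorm (x i 0) by [].
elim/big_rec2: _ => [|i s t _ [ts s0]]; first by rewrite expr0n.
have c0 := cnorm_ge0 (x i 0); split; last exact: addr_ge0.
by nra.
Qed.

Lemma colnorm_scale (a : R[i]) x :
  colnorm (map_mx ( *:%R a) x) = Normc.normc a * colnorm x.
Proof.
have n0 : 0 <= Normc.normc a by case: a => u v; exact: sqrtr_ge0.
have nJ : Normc.normc a^* = Normc.normc a by case: a {n0} => u v; rewrite /= sqrrN.
apply/eqP; rewrite -(@eqrXn2 _ 2) ?mulr_ge0 ?colnorm_ge0 // exprMn !colnorm_sqr.
have -> : col_ip (map_mx ( *:%R a) x) (map_mx ( *:%R a) x) = a^* *: (a *: col_ip x x).
  rewrite !col_ipE !scaler_sumr; apply: eq_bigr => i _.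
  by rewrite !mxE starZ -scalerAl -scalerAr.
by rewrite !cnormZ nJ mulrA expr2.
Qed.

End HilbertModule.

(** * The C*-algebra of matrices *)

Section MatrixNorm.
Variables (R : realType) (A : cstarAlgType R).

Section AnySize.
Variable n : nat.
Implicit Types (x y : 'cV[A]_n) (a b : 'M[A]_n).

Let S a : set R := [set colnorm (a *m x) | x in [set x : 'cV[A]_n | colnorm x <= 1]]%classic.

Lemma mulmx_colnorm_le a x :
  colnorm (a *m x) <= (\sum_i \sum_j cnorm (a i j)) * colnorm x.
Proof.
apply: le_trans (colnorm_le_sum _) _; rewrite mulr_suml; apply: ler_sum => i _.
rewrite mxE mulr_suml; apply: le_trans (cnorm_sum _ _ _) _.
by apply: ler_sum => j _; apply: cnormMle => //; exact: cnorm_entry_le.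
Qed.

Lemma colnorm0 : colnorm (0 : 'cV[A]_n) = 0.
Proof.
by rewrite colnormE col_ipE big1 ?cnorm0 ?sqrtr0 // => i _; rewrite !mxE mulr0.
Qed.

Lemma sum_entries_ge0 a : 0 <= \sum_i \sum_j cnorm (a i j).
Proof. by do 2!apply: sumr_ge0 => ? _; exact: cnorm_ge0. Qed.

Lemma mxcnorm_has_sup a : has_sup (S a).
Proof.
split; first by exists (colnorm (a *m 0)); exists 0 => //=; rewrite colnorm0 ler01.
exists (\sum_i \sum_j cnorm (a i j)) => _ [x /= x1 <-].
by apply: le_trans (mulmx_colnorm_le _ _) _; rewrite ler_piMr ?sum_entries_ge0.
Qed.

Lemma mxcnorm_ge0 a : 0 <= mxcnorm a.
Proof.
apply: ub_le_sup; first by case: (mxcnorm_has_sup a).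
by exists 0 => /=; rewrite ?mulmx0 colnorm0 ?ler01.
Qed.

Lemma colnorm_mulmx a x : colnorm (a *m x) <= mxcnorm a * colnorm x.
Proof.
have := colnorm_ge0 x; rewrite le_eqVlt => /predU1P[/esym x0|x0].
  by rewrite (colnorm_eq0 x0) mulmx0 colnorm0 mulr0.
have nr : Normc.normc (colnorm x)^-1%:C = (colnorm x)^-1.
  by rewrite /Normc.normc /= expr0n addr0 sqrtr_sqr ger0_norm // invr_ge0 ltW.
have : colnorm (a *m map_mx ( *:%R (colnorm x)^-1%:C) x) <= mxcnorm a.
  apply: ub_le_sup; first by case: (mxcnorm_has_sup a).
  eexists; last reflexivity.
  by rewrite /= colnorm_scale nr mulVf // gt_eqF.
have -> : a *m map_mx ( *:%R (colnorm x)^-1%:C) x =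
    map_mx ( *:%R (colnorm x)^-1%:C) (a *m x).
  apply/matrixP => i j; rewrite !mxE scaler_sumr.
  by apply: eq_bigr => k _; rewrite mxE -scalerAr.
by rewrite colnorm_scale nr mulrC ler_pdivrMr.
Qed.

Lemma mxcnorm_le a (M : R) : 0 <= M ->
  (forall x, colnorm (a *m x) <= M * colnorm x) -> mxcnorm a <= M.
Proof.
move=> M0 h; apply: ge_sup; first by case: (mxcnorm_has_sup a).
by move=> _ [x /= x1 <-]; apply: le_trans (h x) _; rewrite ler_piMr.
Qed.

Lemma mxcnorm_le_sum a : mxcnorm a <= \sum_i \sum_j cnorm (a i j).
Proof. by apply: mxcnorm_le; [exact: sum_entries_ge0|exact: mulmx_colnorm_le]. Qed.

Lemma cnorm_entry_le_mx a i j : cnorm (a i j) <= mxcnorm a.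
Proof.
pose e : 'cV[A]_n := delta_mx j 0.
have -> : a i j = (a *m e) i 0 by rewrite -colE mxE.
apply: le_trans (cnorm_entry_le _ _) _; apply: le_trans (colnorm_mulmx _ _) _.
rewrite ler_piMr ?mxcnorm_ge0 //; apply: le_trans (colnorm_le_sum _) _.
rewrite (bigD1 j) //= big1 => [|k kj]; rewrite mxE ?eqxx ?addr0 ?cnorm1 //.
by rewrite (negPf kj) cnorm0.
Qed.

Lemma mxcnormD a b : mxcnorm (a + b) <= mxcnorm a + mxcnorm b.
Proof.
apply: mxcnorm_le => [|x]; first by rewrite addr_ge0 ?mxcnorm_ge0.
rewrite mulmxDl mulrDl; apply: le_trans (colnormD _ _) _.
by apply: lerD; exact: colnorm_mulmx.
Qed.

Lemma mxcnormM a b : mxcnorm (a *m b) <= mxcnorm a * mxcnorm b.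
Proof.
apply: mxcnorm_le => [|x]; first by rewrite mulr_ge0 ?mxcnorm_ge0.
rewrite -mulmxA -mulrA; apply: le_trans (colnorm_mulmx _ _) _.
by apply: ler_wpM2l; rewrite ?mxcnorm_ge0 ?colnorm_mulmx.
Qed.

Lemma mxcnorm_eq0 a : mxcnorm a = 0 -> a = 0.
Proof.
move=> a0; apply/matrixP => i j; rewrite mxE.
by apply: cnorm_eq0_le; rewrite -a0 cnorm_entry_le_mx.
Qed.

Lemma mxcnormZ (c : R[i]) a :
  mxcnorm (map_mx ( *:%R c) a) = Normc.normc c * mxcnorm a.
Proof.
have n0 d : 0 <= Normc.normc (d : R[i]) by case: d => u v; exact: sqrtr_ge0.
have le d b : mxcnorm (map_mx ( *:%R (d : R[i])) b) <= Normc.normc d * mxcnorm b.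
  apply: mxcnorm_le => [|x]; first by rewrite mulr_ge0 ?mxcnorm_ge0.
  have -> : map_mx ( *:%R d) b *m x = map_mx ( *:%R d) (b *m x).
    apply/matrixP => i j; rewrite !mxE scaler_sumr.
    by apply: eq_bigr => k _; rewrite mxE -scalerAl.
  by rewrite colnorm_scale -mulrA ler_wpM2l ?colnorm_mulmx.
apply/eqP; rewrite eq_le le /=; have [->|c0] := eqVneq c 0.
  by rewrite Normc.normc0 mul0r mxcnorm_ge0.
have nc0 : 0 < Normc.normc c.
  by rewrite lt_neqAle n0 andbT eq_sym; apply: contra c0 => /eqP/Normc.eq0_normc/eqP.
have := le c^-1 (map_mx ( *:%R c) a).
have -> : map_mx ( *:%R c^-1) (map_mx ( *:%R c) a) = a.
  by apply/matrixP => i j; rewrite !mxE scalerA mulVf // scale1r.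
by rewrite Normc.normcV ler_pdivlMl // mulrC.
Qed.

(** Cauchy-Schwarz for <a x, a x> = <x, a^* a x> gives one inequality, and the
    other follows because the norm of a^* is that of a. *)
Lemma mxcnorm_cstar a : mxcnorm (adjmx a *m a) = mxcnorm a ^+ 2.
Proof.
have le b : mxcnorm b ^+ 2 <= mxcnorm (adjmx b *m b).
  suff : mxcnorm b <= Num.sqrt (mxcnorm (adjmx b *m b)).
    rewrite -(@ler_pXn2r _ 2) ?nnegrE ?mxcnorm_ge0 ?sqrtr_ge0 //.
    by rewrite sqr_sqrtr ?mxcnorm_ge0.
  apply: mxcnorm_le => [|x]; first exact: sqrtr_ge0.
  rewrite -(@ler_pXn2r _ 2) ?nnegrE ?mulr_ge0 ?sqrtr_ge0 ?colnorm_ge0 //.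
  rewrite exprMn (sqr_sqrtr (mxcnorm_ge0 _)) colnorm_sqr col_ip_adj mulmxA.
  apply: le_trans (cauchy_schwarz _ _) _; rewrite mulrC expr2 mulrA.
  by apply: ler_wpM2r; rewrite ?colnorm_ge0 ?colnorm_mulmx.
have ns b : mxcnorm b <= mxcnorm (adjmx b).
  have := mxcnorm_ge0 b; rewrite le_eqVlt => /predU1P[<-|b0].
    exact: mxcnorm_ge0.
  rewrite -(ler_pM2r b0) -expr2; apply: le_trans (le b) _; exact: mxcnormM.
have nE : mxcnorm (adjmx a) = mxcnorm a.
  by apply/eqP; rewrite eq_le ns andbT -{2}(adjmxK a) ns.
by apply/eqP; rewrite eq_le le andbT expr2 -{1}nE mxcnormM.
Qed.

Lemma mxcnorm_complete (u : nat -> 'M[A]_n) :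
  (forall e : R, 0 < e -> exists N, forall k l, (N <= k)%N -> (N <= l)%N ->
     mxcnorm (u k - u l) < e) ->
  exists l, ((fun k => mxcnorm (u k - l)) @ \oo --> (0 : R))%classic.
Proof.
move=> hu.
have hl i j : exists l : A, ((fun k => cnorm (u k i j - l)) @ \oo --> (0 : R))%classic.
  apply: cnorm_complete => e /hu[N hN]; exists N => k l Nk Nl.
  apply: le_lt_trans (hN _ _ Nk Nl).
  by have := cnorm_entry_le_mx (u k - u l) i j; rewrite !mxE.
pose l i := projT1 (choice (hl i)).
have ll i j : ((fun k => cnorm (u k i j - l i j)) @ \oo --> (0 : R))%classic.
  exact: (projT2 (choice (hl i)) j).
exists (\matrix_(i, j) l i j).
apply: (@squeeze_cvgr _ _ _ _ (fun=> 0)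
  (fun k => \sum_i \sum_j cnorm (u k i j - l i j))); last 2 first.
- exact: cvg_cst.
- by apply: cvg0_sum => i; apply: cvg0_sum => j; exact: ll.
apply: nearW => k; rewrite mxcnorm_ge0 /=; apply: le_trans (mxcnorm_le_sum _) _.
by apply: ler_sum => i _; apply: ler_sum => j _; rewrite !mxE.
Qed.

End AnySize.
End MatrixNorm.

(** A copy of the matrices: they are already a module over A, whereas a
    C*-algebra takes its scalars in R[i]. *)
Definition cstar_mx (R : realType) (A : cstarAlgType R) (n : nat) : Type := 'M[A]_n.+1.

Section MatrixAlgebra.
Variables (R : realType) (A : cstarAlgType R) (n : nat).
Local Notation M := (cstar_mx A n).
HB.instance Definition _ := GRing.NzRing.on M.

Definition cstar_mx_scale (c : R[i]) (a : M) : M := map_mx ( *:%R c) (a : 'M[A]_n.+1).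

Fact cstar_mx_scaleA c d a : cstar_mx_scale c (cstar_mx_scale d a) = cstar_mx_scale (c * d) a.
Proof. by apply/matrixP => i j; rewrite !mxE scalerA. Qed.
Fact cstar_mx_scale1 : left_id 1 cstar_mx_scale.
Proof. by move=> a; apply/matrixP => i j; rewrite !mxE scale1r. Qed.
Fact cstar_mx_scaleDr : right_distributive cstar_mx_scale +%R.
Proof. by move=> c a b; apply/matrixP => i j; rewrite !mxE scalerDr. Qed.
Fact cstar_mx_scaleDl a : {morph cstar_mx_scale^~ a : c d / c + d}.
Proof. by move=> c d; apply/matrixP => i j; rewrite !mxE scalerDl. Qed.
HB.instance Definition _ := GRing.Zmodule_isLmodule.Build R[i] M
  cstar_mx_scaleA cstar_mx_scale1 cstar_mx_scaleDr cstar_mx_scaleDl.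

Fact cstar_mx_scaleAl (c : R[i]) (a b : M) : c *: (a * b) = (c *: a) * b.
Proof.
apply/matrixP => i j; rewrite !mxE scaler_sumr.
by apply: eq_bigr => k _; rewrite mxE scalerAl.
Qed.
HB.instance Definition _ := GRing.LSemiModule_isLSemiAlgebra.Build R[i] M cstar_mx_scaleAl.
Fact cstar_mx_scaleAr (c : R[i]) (a b : M) : c *: (a * b) = a * (c *: b).
Proof.
apply/matrixP => i j; rewrite !mxE scaler_sumr.
by apply: eq_bigr => k _; rewrite mxE scalerAr.
Qed.
HB.instance Definition _ := GRing.LSemiAlgebra_isSemiAlgebra.Build R[i] M cstar_mx_scaleAr.

Fact cstar_mx_starZ (c : R[i]) (a : M) : adjmx (c *: a) = c^* *: (adjmx a : M) :> M.
Proof. by apply/matrixP => i j; rewrite !mxE starZ. Qed.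

HB.instance Definition _ := hasStar.Build R[i] M
  (@adjmxK _ A n.+1 n.+1) (@adjmxD _ A n.+1 n.+1) cstar_mx_starZ (@adjmxM _ A n.+1 n.+1 n.+1).

HB.instance Definition _ := isCStar.Build R M
  (@mxcnormD _ A n.+1) (@mxcnormZ _ A n.+1) (@mxcnorm_eq0 _ A n.+1)
  (@mxcnormM _ A n.+1) (@mxcnorm_cstar _ A n.+1) (@mxcnorm_complete _ A n.+1).

Lemma psdmxD (a b : 'M[A]_n.+1) : psdmx a -> psdmx b -> psdmx (a + b).
Proof. by move=> [c ->] [d ->]; exact: (@star_mulD R M c d). Qed.

Lemma psdmx_sum (I : Type) (s : seq I) (P : pred I) (F : I -> 'M[A]_n.+1) :
  (forall i, P i -> psdmx (F i)) -> psdmx (\sum_(i <- s | P i) F i).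
Proof.
move=> h; elim/big_rec: _ => [|i b Pi pb]; first by exists 0; rewrite mulmx0.
by apply: psdmxD => //; exact: h.
Qed.

(** e^* e is the sum over the rows of e of rank-one squares, each of which is
    c^* c for the square matrix c holding that row. *)
Lemma psdmx_gram N (e : 'M[A]_(N, n.+1)) : psdmx (adjmx e *m e).
Proof.
have -> : adjmx e *m e = \sum_k adjmx (row k e) *m row k e.
  apply/matrixP => i j; rewrite mxE summxE; apply: eq_bigr => k _.
  by rewrite [RHS]mxE big_ord1 !adjmxE !mxE.
apply: psdmx_sum => k _.
exists (\matrix_(i, j) (if i == 0 then e k j else 0)).
apply/matrixP => i j; rewrite [LHS]mxE [RHS]mxE big_ord1 (bigD1 ord0) //= !adjmxE !mxE eqxx.
by rewrite big1 ?addr0 // => l /negPf l0; rewrite !mxE l0 mulr0.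
Qed.

Lemma mxcnorm_complement (a : 'M[A]_n.+1) (r : R) : 0 < r -> mxcnorm a <= r ->
  exists c : 'M[A]_n.+1, ((r ^+ 2)%:C *: 1)%:M - adjmx a *m a = adjmx c *m c.
Proof.
move=> r0 ar; have [c e] := @star_mul_complement R M a r r0 ar; exists c.
apply: (etrans _ e); congr (_ - _); apply/matrixP => i j; rewrite !mxE.
by case: eqP; rewrite ?mulr1n ?mulr0n ?scaler0.
Qed.

End MatrixAlgebra.

(** * The space of noncommutative polynomials *)

(** Turns a function that is only provably linear into an object to which the
    theory of linear maps applies. *)
Lemma exists_linear (K : pzRingType) (U V : lmodType K) (f : U -> V) :
  linear f -> exists g : {linear U -> V}, g =1 f.
Proof.
move=> h.
pose g : {linear U -> V} := HB.pack_for {linear U -> V} f (GRing.isLinear.Build K U V *:%R f h).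
by exists g.
Qed.

Section Words.
Variables (C : numClosedFieldType) (B : starAlgType C).

Lemma ncpoly_sum_words (f : ncpoly B) : f = \sum_(w <- repr f) ncword w.
Proof.
transitivity (tmk (repr f) : ncpoly B); first by rewrite /tmk reprK.
elim: (repr f) => [|w p IH]; first by rewrite big_nil.
rewrite big_cons -IH; apply: tens_ext => U F bF.
by rewrite tliftDr // !tliftE // /weval big_cons big_seq1.
Qed.

Lemma star_ncword w : star (ncword w) = ncword (wstar w) :> ncpoly B.
Proof.
apply: tens_ext => U F bF; rewrite [LHS]tlift_star // !tliftE //.
  by rewrite /weval !big_seq1.
exact: bal_wstar.
Qed.

Lemma Xword_rcons s (c : B) : Xword (rcons s c) = Xword s * (ncX B * ncC c).
Proof. by rewrite /Xword -cats1 big_cat big_seq1. Qed.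

Lemma Xword_nil : Xword [::] = 1 :> ncpoly B.
Proof. by rewrite /Xword big_nil. Qed.

End Words.

(** * Positivity of the compressed cumulant map *)

Section BooleanPositivity.
Variables (R : realType) (B D : cstarAlgType R).
Variables (iota : {lrmorphism B -> D}) (mu : {linear ncpoly B -> D}).
Hypothesis muS : in_Sigma iota mu.
Local Notation bcum := (bcum mu).
Local Notation X := (ncX B).

Lemma psdmx_adj n (a : 'M[D]_n) : psdmx a -> adjmx a = a.
Proof. by move=> [c ->]; rewrite adjmxM adjmxK. Qed.

(** The matrix of (P) for the pair (1, f) is selfadjoint. *)
Lemma hermitian_of_propertyP (phi : ncpoly B -> D) f :
  propertyP phi -> phi (star f) = star (phi f).
Proof.
move=> P; pose g (i : 'I_2) : ncpoly B := if i == 0 then 1 else f.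
have /matrixP/(_ 1 0) := psdmx_adj (P 2%N g isT).
by rewrite adjmxE !mxE /g /= mulr1 star1 mul1r => ->.
Qed.

(** < Q X xi, f(Q X Q) (Q X xi) >: the outer factors X leave xi and return to
    it, and beta forbids returns in between. *)
Definition sigma_of (f : ncpoly B) : D := boolean_beta iota mu (X * f * X).

Lemma sigma_of_linear : linear sigma_of.
Proof.
move=> a f g; rewrite /sigma_of mulrDr mulrDl -scalerAr -scalerAl.
exact: (boolean_beta_linear iota mu).
Qed.

Lemma sigma_of_word w : sigma_of (ncword w) = bcum (rcons (w.1 :: w.2) 1).
Proof.
case: w => b s; rewrite /sigma_of ncwordE mulrA.
have -> : X * ncC b * Xword s * X = Xword (rcons (b :: s) 1).
  by rewrite Xword_rcons ncC1 mulr1 /Xword big_cons.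
by rewrite boolean_beta_Xword.
Qed.

(** The covector  xi^* X b0 Q X b1 Q ... X bm Q  of l = [:: b0; ...; bm]; a pair
    (d, g) stands for the functional h |-> d mu (g h).  With Q_j = 1 - P_j for
    the successive factors Q, where P_j projects onto xi D, the expansion
    Q_1 Q_2 ... = 1 - P_1 - Q_1 P_2 - Q_1 Q_2 P_3 - ...  produces, before the
    only P_j of a term, the cumulant of an initial segment of l. *)
Definition covector (l : seq B) : seq (D * ncpoly B) :=
  (1, Xword l) :: [seq (- bcum (take j l), Xword (drop j l)) | j <- seq.iota 1 (size l)].

Definition covector_eval l h := \sum_(p <- covector l) p.1 * mu (p.2 * h).

Lemma covector_rcons l c : covector (rcons l c) =
  rcons [seq (p.1, p.2 * (X * ncC c)) | p <- covector l] (- bcum (rcons l c), 1).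
Proof.
rewrite /covector /= size_rcons -(addn1 (size l)) iotaD map_cat /= add1n cats1 Xword_rcons.
congr (_ :: rcons _ (- bcum _, _)).
- rewrite -map_comp; apply/eq_in_map => j; rewrite mem_iota add1n ltnS => /andP[_ jl].
  by rewrite /= -cats1 takel_cat // cats1 drop_rcons // Xword_rcons.
- by rewrite take_oversize ?size_rcons.
- by rewrite drop_oversize ?size_rcons // Xword_nil.
Qed.

Lemma covector_eval_rcons l c h : covector_eval (rcons l c) h =
  covector_eval l (X * ncC c * h) - bcum (rcons l c) * mu h.
Proof.
rewrite /covector_eval covector_rcons -cats1 big_cat big_seq1 big_map mul1r mulNr.
by congr (_ - _); apply: eq_bigr => p _; rewrite -!mulrA.
Qed.

(** The covector ends with Q, so it vanishes on xi, except when it is xi^*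
    itself; this is the recursion defining the cumulants. *)
Lemma covector_eval_unit l : covector_eval l 1 = (l == [::])%:R.
Proof.
case: l => [|c l].
  by rewrite /covector_eval big_seq1 Xword_nil mulr1 mul1r (Sigma_unital muS).
rewrite /covector_eval big_cons mul1r mulr1 big_map -/(index_iota 1 (size (c :: l)).+1).
rewrite big_nat_recr //= drop_size take_size Xword_nil mulr1.
rewrite (Sigma_unital muS) mulr1 [X in - X]bcumE // opprB.
under eq_bigr do rewrite mulr1 mulNr.
by rewrite sumrN addKr subrr.
Qed.

(** The letter c passes through the Q that ends the covector, because they
    commute; inserting 1 = Q + xi xi^* after X then lengthens the covector by one
    letter and creates a multiple of xi^*, whose coefficient is a cumulant. *)
Lemma covector_eval_step l x c h : covector_eval (rcons l x) (ncC c * X * h) =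
  covector_eval (rcons (rcons l (x * c)) 1) h + bcum (rcons (rcons l (x * c)) 1) * mu h.
Proof.
have move_coef g : covector_eval (rcons l x) (ncC c * g) = covector_eval (rcons l (x * c)) g.
  have muC : mu (ncC c * g) = iota c * mu g.
    by have := Sigma_bimodule muS c g 1; rewrite ncC1 !mulr1 rmorph1 mulr1.
  by rewrite !covector_eval_rcons ncCM (bcum_rcons muS) muC !mulrA.
by rewrite -mulrA move_coef [in RHS]covector_eval_rcons ncC1 mulr1 subrK.
Qed.

Definition covector_form (l l' : seq B) : D :=
  \sum_(p <- covector l) \sum_(q <- covector l') p.1 * mu (p.2 * star q.2) * star q.1.

Lemma covector_formE l l' :
  covector_form l l' = \sum_(q <- covector l') covector_eval l (star q.2) * star q.1.
Proof.
rewrite /covector_form exchange_big; apply: eq_bigr => q _.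
by rewrite /covector_eval mulr_suml.
Qed.

Lemma covector_form_nil l : l != [::] -> covector_form l [::] = 0.
Proof.
move=> l0; rewrite covector_formE big_seq1 Xword_nil [star 1]star1.
by rewrite covector_eval_unit (negPf l0) mul0r.
Qed.

Lemma star_ncX_ncC c (f : ncpoly B) :
  star (f * (X * ncC c)) = ncC (star c) * X * star f.
Proof. by rewrite !starM ncX_star ncC_star. Qed.

(** Strip the second covector from its end.  By [covector_eval_step] each letter
    moves to the first covector; the term in xi^* created on the way is paired
    with a vector orthogonal to xi, except at the last letter, where it is the
    result. *)
Lemma covector_form_rcons p x q c : covector_form (rcons p x) (rcons q c) =
  bcum (p ++ (x * star c) :: rcons (rev (map star q)) 1).
Proof.
have step p' x' q' c' : covector_form (rcons p' x') (rcons q' c') =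
    covector_form (rcons (rcons p' (x' * star c')) 1) q' +
    bcum (rcons (rcons p' (x' * star c')) 1) * (q' == [::])%:R.
  rewrite covector_formE covector_rcons -cats1 big_cat big_seq1 big_map /=.
  rewrite [star 1]star1 covector_eval_unit.
  have -> : (rcons p' x' == [::]) = false by case: (p').
  rewrite mul0r addr0 covector_formE.
  have -> : (q' == [::])%:R = \sum_(r <- covector q') mu (star r.2) * star r.1 :> D.
    have -> : (q' == [::])%:R = star (covector_eval q' 1).
      by rewrite covector_eval_unit; case: (_ == _); rewrite ?star1 ?star0.
    rewrite star_sum; apply: eq_bigr => r _.
    by rewrite mulr1 starM -hermitian_of_propertyP //; exact: Sigma_P muS.
  rewrite mulr_sumr -big_split /=; apply: eq_bigr => r _.
  by rewrite star_ncX_ncC covector_eval_step mulrDl mulrA.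
elim/last_ind: q p x c => [|q c' IH] p x c; rewrite step.
  rewrite covector_form_nil ?mulr1 ?add0r; last by case: (rcons p _).
  by rewrite -!cats1 -catA.
rewrite IH mul1r map_rcons rev_rcons /= cat_rcons.
by case: (q) => [|??]; rewrite mulr0 addr0.
Qed.

Lemma sigma_of_kform b s b' s' :
  sigma_of (ncword (nc_wmul (b, s) (wstar (b', s')))) = covector_form (b :: s) (b' :: s').
Proof.
(* Gluing happens at the last letter of the left factor, so lists are split from
   the right. *)
have eqr c t : c :: t = rcons (belast c t) (last c t) by rewrite lastI.
rewrite [in RHS]eqr [b' :: s']eqr covector_form_rcons.
have -> : (b, s) = word_of (rcons (belast b s) (last b s)) by rewrite -eqr.
rewrite glue_word_of /wstar [(b', s').1 :: _](eqr _ b' s') map_rcons rev_rcons /word_of /=.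
rewrite sigma_of_word /=; congr bcum.
by case: (belast b s) => [|c t] //=; rewrite rcons_cat.
Qed.

Definition covector_of (f : ncpoly B) : seq (D * ncpoly B) :=
  flatten [seq covector ((wstar w).1 :: (wstar w).2) | w <- repr f].

Lemma sigma_of_gram f g : sigma_of (star f * g) =
  \sum_(p <- covector_of f) \sum_(q <- covector_of g) p.1 * mu (p.2 * star q.2) * star q.1.
Proof.
have lin (I : Type) (s : seq I) (F : I -> ncpoly B) :
    sigma_of (\sum_(i <- s) F i) = \sum_(i <- s) sigma_of (F i).
  have [sg sgE] := exists_linear sigma_of_linear.
  by rewrite -sgE linear_sum; apply: eq_bigr => i _; rewrite sgE.
rewrite {1}[f]ncpoly_sum_words {1}[g]ncpoly_sum_words star_sum mulr_suml lin.
rewrite big_flatten big_map; apply: eq_bigr => w _.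
rewrite mulr_sumr lin exchange_big big_flatten big_map; apply: eq_bigr => w' _.
rewrite exchange_big star_ncword ncwordM -{1}(wstarK w').
by rewrite (surjective_pairing (wstar w)) (surjective_pairing (wstar w')) sigma_of_kform.
Qed.

Lemma big_nth_padded (V : nmodType) (T : Type) (x0 : T) (s : seq T) m (F : T -> V) :
  F x0 = 0 -> (size s <= m)%N -> \sum_(x <- s) F x = \sum_(k < m) F (nth x0 s k).
Proof.
move=> F0 sm; rewrite (big_nth x0) big_mkord (big_ord_widen _ (fun k => F (nth x0 s k)) sm).
rewrite big_mkcond; apply: eq_bigr => k _; case: ltnP => // sk.
by rewrite nth_default.
Qed.

(** The covectors of f_0, ..., f_n are padded to a common length m, so that the
    pairs (i, k) with k < m index all polynomials that occur; e collects the
    coefficients, its column i being supported on the pairs (i, k). *)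
Lemma sigma_of_propertyP : propertyP sigma_of.
Proof.
case=> [|n] f // _; pose V i := covector_of (f i).
pose m := \max_i size (V i).
pose T := ('I_n.+1 * 'I_m)%type; pose N := #|{: T}|.
pose v (t : T) := nth (0, 0) (V t.1) t.2.
pose g (a : 'I_N) := star (v (enum_val a)).2.
pose e : 'M[D]_(N, n.+1) := \matrix_(a, i)
  if (enum_val a).1 == i then star (v (enum_val a)).1 else 0.
(* (P) concerns nonempty families; here every f_i has an empty covector. *)
have [N0|N0] := posnP N.
  exists 0; apply/matrixP => j i; rewrite mulmx0 !mxE sigma_of_gram.
  have V0 k : V k = [::].
    apply/nilP; rewrite /nilp -leqn0 -[0%N](_ : m = _) ?leq_bigmax //.
    by move: N0; rewrite /N card_prod !card_ord mulSn; case: (m).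
  by rewrite -/(V j) V0 big_nil.
have [c ec] := Sigma_P muS g N0.
suff -> : (\matrix_(j, i) sigma_of (star (f j) * f i)) = adjmx (c *m e) *m (c *m e).
  exact: psdmx_gram.
rewrite adjmxM mulmxA -(mulmxA (adjmx e)) -ec.
apply/matrixP => j i; rewrite mxE sigma_of_gram.
have big_e (F : T -> D) l : \sum_(k < m) F (l, k) =
    \sum_(a < N) if (enum_val a).1 == l then F (enum_val a) else 0.
  rewrite -(big_enum_val (fun t : T => if t.1 == l then F t else 0)) /=.
  transitivity (\sum_(t : T) if t.1 == l then F (t.1, t.2) else 0); last first.
    by apply: eq_bigr => -[].
  rewrite -(pair_bigA _ (fun l' k => if l' == l then F (l', k) else 0)) /=.
  rewrite (bigD1 l) //= [X in _ + X]big1 ?addr0 => [|l' /negPf ll].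
    by apply: eq_bigr => k _; rewrite eqxx.
  by rewrite big1 // => k _; rewrite ll.
have sV k : (size (V k) <= m)%N by exact: leq_bigmax.
rewrite -/(V j) -/(V i) (big_nth_padded (x0 := (0, 0)) _ (sV j)); last first.
  by rewrite big1 // => q _; rewrite !mul0r.
rewrite (big_e (fun t => \sum_(q <- V i) (v t).1 * mu ((v t).2 * star q.2) * star q.1)).
rewrite [RHS]mxE; under [RHS]eq_bigr do rewrite [X in X * _]mxE mulr_suml.
rewrite [RHS]exchange_big; apply: eq_bigr => a _ /=.
case: eqP => ja; last first.
  rewrite big1 // => b _; rewrite adjmxE [e a j]mxE; case: eqP => //= _.
  by rewrite star0 !mul0r.
rewrite (big_nth_padded (x0 := (0, 0)) _ (sV i)); last by rewrite /= [star (0 : D)]star0 mulr0.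
rewrite (big_e (fun t =>
  (v (enum_val a)).1 * mu ((v (enum_val a)).2 * star (v t).2) * star (v t).1)).
apply: eq_bigr => b _; rewrite adjmxE !mxE ja eqxx starK /g starK.
by case: eqP => // _; rewrite mulr0.
Qed.

End BooleanPositivity.

(** * The identity at nilpotent points *)

Section TensorEvaluation.
Variables (C : numClosedFieldType) (B : starAlgType C).

(** Evaluation v |-> X v of the tensor algebra, which carries nilpotency over
    the tensor algebra to X b. *)
Definition tens_word (w : tword C^o B) : ncpoly B := (w.1 : C) *: Xword w.2.
Definition tens_to_nc : tensalg B -> ncpoly B := tlift tens_word.

Lemma Xword_cat (s t : seq B) : Xword (s ++ t) = Xword s * Xword t.
Proof. by rewrite /Xword big_cat. Qed.

Lemma ncC0 : ncC (0 : B) = 0.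
Proof. by have := ncCZD (-1) (0 : B) 0; rewrite scaler0 addr0 scaleN1r addNr. Qed.

Lemma ncCZ (a : C) (b : B) : ncC (a *: b) = a *: ncC b.
Proof. by rewrite -[a *: b]addr0 ncCZD ncC0 addr0. Qed.

Lemma ncCD (b b' : B) : ncC (b + b') = ncC b + ncC b'.
Proof. by rewrite -{1}[b]scale1r ncCZD scale1r. Qed.

Lemma bal_tens_word : balanced tens_word.
Proof.
split=> [m m' s|m s v v' s'|a m s v s']; rewrite /tens_word /=.
- exact: scalerDl.
- by rewrite !Xword_cat /Xword !big_cons ncCD mulrDr mulrDl mulrDr scalerDr.
- rewrite !Xword_cat /Xword !big_cons ncCZ.
  by rewrite -!(scalerAl, scalerAr) scalerA mulrC.
Qed.

Lemma tens_to_ncD x y : tens_to_nc (x + y) = tens_to_nc x + tens_to_nc y.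
Proof. exact: tliftDr bal_tens_word. Qed.

Lemma tens_to_nc0 : tens_to_nc 0 = 0.
Proof. by apply: (addrI (tens_to_nc 0)); rewrite -tens_to_ncD !addr0. Qed.

Lemma tens_to_ncM x y : tens_to_nc (x * y) = tens_to_nc x * tens_to_nc y.
Proof.
rewrite /tens_to_nc [LHS](tlift_mul _ _ _ bal_tens_word) /tlift mulr_suml.
apply: eq_bigr => w _; rewrite mulr_sumr; apply: eq_bigr => w' _.
by rewrite /tens_word /cat_wmul /= Xword_cat -scalerAl -scalerAr scalerA.
Qed.

Lemma tens_to_nc_in v : tens_to_nc (tens_in v) = ncX B * ncC v.
Proof.
rewrite /tens_to_nc tliftE; last exact: bal_tens_word.
by rewrite /weval big_seq1 /tens_word /= scale1r /Xword big_seq1.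
Qed.

Lemma tens_to_nc1 : tens_to_nc 1 = 1.
Proof.
rewrite /tens_to_nc tliftE; last exact: bal_tens_word.
by rewrite /weval big_seq1 /tens_word /= scale1r Xword_nil.
Qed.

Lemma map_tens_to_ncX n (a : 'M[tensalg B]_n) r :
  map_mx tens_to_nc (a ^+ r) = map_mx tens_to_nc a ^+ r.
Proof.
elim: r => [|r IH].
  apply/matrixP => i j; rewrite !expr0 !mxE.
  by case: eqP; rewrite ?mulr1n ?mulr0n ?tens_to_nc1 ?tens_to_nc0.
rewrite !exprS -IH; apply/matrixP => i j; rewrite !mxE.
rewrite (big_morph _ tens_to_ncD tens_to_nc0); apply: eq_bigr => k _.
by rewrite tens_to_ncM !mxE.
Qed.
End TensorEvaluation.

Lemma mul_scalar_mxE (K : pzRingType) m n (a : K) (A : 'M[K]_(m, n)) i j :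
  (a%:M *m A) i j = a * A i j.
Proof. by rewrite mul_scalar_mx mxE. Qed.

Lemma mul_mx_scalarE (K : pzRingType) m n (a : K) (A : 'M[K]_(m, n)) i j :
  (A *m a%:M) i j = A i j * a.
Proof.
rewrite mxE (bigD1 j) //= mxE eqxx mulr1n big1 ?addr0 // => k /negPf kj.
by rewrite mxE kj mulr0n mulr0.
Qed.

Section Identity.
Variables (R : realType) (B D : cstarAlgType R).
Variables (iota : {lrmorphism B -> D}) (mu : {linear ncpoly B -> D}).
Hypothesis muS : in_Sigma iota mu.
Local Notation X := (ncX B).
Local Notation beta := (boolean_beta iota mu).
Local Notation sigma := (sigma_of iota mu).

Lemma Xb_nilp n (b : 'M[B]_n) : Nilp b -> exists r, Xb b ^+ r = 0.
Proof.
move=> [r br]; exists r.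
have -> : Xb b = map_mx (@tens_to_nc _ B) (map_mx (@tens_in R[i] B) b).
  by apply/matrixP => i j; rewrite mul_scalar_mxE !mxE tens_to_nc_in.
rewrite -map_tens_to_ncX br; apply/matrixP => i j.
by rewrite !mxE tens_to_nc0.
Qed.

Lemma map_beta_sum n (I : Type) (s : seq I) (F : I -> 'M[ncpoly B]_n) :
  map_mx beta (\sum_(i <- s) F i) = \sum_(i <- s) map_mx beta (F i).
Proof.
have [g gE] := exists_linear (boolean_beta_linear iota mu).
apply/matrixP => i j; rewrite mxE !summxE -gE linear_sum.
by apply: eq_bigr => k _; rewrite mxE gE.
Qed.

Lemma map_beta_mulC n (A : 'M[ncpoly B]_n) (b : 'M[B]_n) :
  map_mx beta (A *m map_mx (@ncC _ B) b) = map_mx beta A *m map_mx iota b.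
Proof.
have [g gE] := exists_linear (boolean_beta_linear iota mu).
apply/matrixP => i j; rewrite !mxE -gE linear_sum; apply: eq_bigr => k _.
rewrite gE !mxE; have := boolean_beta_bimodule muS 1 (A i k) (b k j).
by rewrite ncC1 !mul1r rmorph1 mul1r.
Qed.

Lemma beta_X : beta X = mu X.
Proof.
have -> : X = Xword [:: 1] by rewrite /Xword big_seq1 ncC1 mulr1.
by rewrite boolean_beta_Xword // bcumE //= big_geq // subr0.
Qed.

Lemma beta_Xb1 n (b : 'M[B]_n) :
  map_mx beta (Xb b ^+ 1) = (mu X)%:M *m map_mx iota b.
Proof.
rewrite expr1 /Xb map_beta_mulC; congr (_ *m _); apply/matrixP => i j.
rewrite !mxE; have [g gE] := exists_linear (boolean_beta_linear iota mu).
by case: eqP => _; rewrite ?mulr1n ?beta_X // !mulr0n -gE linear0.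
Qed.

Lemma beta_XbSS n (b : 'M[B]_n) k :
  map_mx beta (Xb b ^+ k.+2) =
    map_mx sigma (map_mx (@ncC _ B) b *m Xb b ^+ k) *m map_mx iota b.
Proof.
have -> : Xb b ^+ k.+2 =
    (X%:M *m (map_mx (@ncC _ B) b *m Xb b ^+ k) *m X%:M) *m map_mx (@ncC _ B) b.
  by rewrite exprSr exprS -!mulmxE /Xb !mulmxA.
rewrite map_beta_mulC; congr (_ *m _); apply/matrixP => i j.
by rewrite mxE mul_mx_scalarE mul_scalar_mxE [RHS]mxE.
Qed.

Lemma beta_Xb_sum n (b : 'M[B]_n) N :
  \sum_(1 <= k < N.+2) map_mx beta (Xb b ^+ k) =
  ((mu X)%:M + \sum_(0 <= k < N) map_mx sigma (map_mx (@ncC _ B) b *m Xb b ^+ k))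
    *m map_mx iota b.
Proof.
rewrite big_nat_recl // beta_Xb1 mulmxDl; congr (_ + _).
rewrite mulmx_suml big_add1 /=.
apply: eq_bigr => k _; exact: beta_XbSS.
Qed.

Lemma resolvent_sum n (b : 'M[B]_n) r N : Xb b ^+ r = 0 -> (r <= N)%N ->
  resolvent b = \sum_(0 <= k < N) Xb b ^+ k.
Proof.
move=> br rN; rewrite /resolvent big_mkord fsbig_ord; apply/esym/fsbig_widen => //.
move=> k /= [_ /negP kN]; rewrite -leqNgt in kN.
by rewrite -(subnK (leq_trans rN kN)) exprD br mulr0.
Qed.

Lemma boolean_identity n (b : 'M[B]_n) : Nilp b ->
  Bfun iota mu b =
    ((mu X)%:M + map_mx sigma (map_mx (@ncC _ B) b *m resolvent b)) *m map_mx iota b.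
Proof.
move=> /Xb_nilp[r br].
rewrite /Bfun {1}(resolvent_sum br (leq_trans (leqnSn r) (leqnSn _))).
rewrite map_beta_sum big_nat_recl // (resolvent_sum br (leqnn r)).
have -> : map_mx beta (Xb b ^+ 0) = 1%:M.
  apply/matrixP => i j; rewrite expr0 !mxE.
  have [g gE] := exists_linear (boolean_beta_linear iota mu).
  by case: eqP => _; rewrite ?mulr1n ?(boolean_beta_unital iota mu) // !mulr0n -gE linear0.
have -> : \sum_(0 <= k < r.+1) map_mx beta (Xb b ^+ k.+1) =
    \sum_(1 <= k < r.+2) map_mx beta (Xb b ^+ k) by rewrite big_add1.
rewrite [1%:M + _]addrC addrK beta_Xb_sum.
congr ((_ + _) *m _); have [g gE] := exists_linear (sigma_of_linear iota mu).
rewrite mulmx_sumr; apply/matrixP => i j; rewrite mxE !summxE -gE linear_sum.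
by apply: eq_bigr => k _; rewrite [LHS]mxE gE.
Qed.

End Identity.

(** * Growth of cumulants *)

Section Moments.
Variables (R : realType) (B D : cstarAlgType R).
Variables (iota : {lrmorphism B -> D}) (mu : {linear ncpoly B -> D}).
Hypotheses (iotaP : cstar_inclusion iota) (muS : in_Sigma iota mu).
Local Notation X := (ncX B).
Local Notation bcum := (bcum mu).
Local Notation sigma := (sigma_of iota mu).
Variable M : R.
Hypotheses (M0 : 0 < M) (muM : forall s : seq B,
    cnorm (mu (X * \prod_(b <- s) (ncC b * X))) <=
      M ^+ (size s).+1 * \prod_(b <- s) cnorm b).

Local Notation cn s := (\prod_(b <- s) cnorm b).

Lemma prod_cnorm_ge0 (s : seq B) : 0 <= cn s.
Proof. by apply: prodr_ge0 => b _; exact: cnorm_ge0. Qed.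

Lemma Xword_mulX (s : seq B) : Xword s * X = X * \prod_(b <- s) (ncC b * X).
Proof.
elim: s => [|b s IH]; first by rewrite Xword_nil big_nil mul1r mulr1.
by rewrite /Xword !big_cons -/(Xword s) -mulrA IH !mulrA.
Qed.

Lemma mu_Xword_bound s : (0 < size s)%N ->
  cnorm (mu (Xword s)) <= M ^+ size s * cn s.
Proof.
case/lastP: s => // s c _; rewrite Xword_rcons mulrA.
have -> : mu (Xword s * X * ncC c) = mu (Xword s * X) * iota c.
  by have := Sigma_bimodule muS 1 (Xword s * X) c; rewrite ncC1 !mul1r rmorph1 mul1r.
rewrite size_rcons -cats1 big_cat big_seq1 mulrA Xword_mulX.
by apply: cnormMle; rewrite ?muM // (iotaP.2 c).
Qed.

Lemma sum_pow2 n : \sum_(0 <= j < n) 2 ^+ j = 2 ^+ n - 1 :> R.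
Proof.
elim: n => [|n IH]; first by rewrite big_geq // expr0 subrr.
by rewrite big_nat_recr //= IH exprS mulr2n mulrDl mul1r addrAC.
Qed.

(** Induction on the recursion: 1 + 2 + ... + 2^(n-1) <= 2^n. *)
Lemma bcum_bound s : (0 < size s)%N ->
  cnorm (bcum s) <= (2 * M) ^+ size s * cn s.
Proof.
have [n] := ubnP (size s); elim: n s => // n IHn s sn s0.
rewrite bcumE //; apply: le_trans (cnormB _ _) _.
apply: (@le_trans _ _ (M ^+ size s * cn s * (1 + \sum_(1 <= j < size s) 2 ^+ j))).
  rewrite mulrDr mulr1; apply: lerD; first exact: mu_Xword_bound.
  rewrite mulr_sumr; apply: le_trans (cnorm_sum _ _ _) _.
  rewrite big_nat_cond [leRHS]big_nat_cond; apply: ler_sum => j /andP[/andP[j1 js] _].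
  have st : size (take j s) = j by rewrite size_takel // ltnW.
  have sd : size (drop j s) = (size s - j)%N by rewrite size_drop.
  have := IHn (take j s); rewrite st => /(_ _ j1) h1.
  have := @mu_Xword_bound (drop j s); rewrite sd subn_gt0 => /(_ js) h2.
  apply: le_trans (cnormMle (h1 _) h2) _; first by rewrite -ltnS (leq_trans _ sn).
  have -> : cn s = cn (take j s) * cn (drop j s) by rewrite -big_cat cat_take_drop.
  have -> : M ^+ size s = M ^+ j * M ^+ (size s - j) by rewrite -exprD subnKC // ltnW.
  rewrite exprMn; move: (M ^+ j) (M ^+ (size s - j)) (2 ^+ j) (cn _) (cn _) => a b c d e.
  by rewrite le_eqVlt; apply/orP; left; apply/eqP; ring.
rewrite exprMn [2 ^+ _ * _]mulrC -mulrA [cn s * _]mulrC mulrA.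
rewrite ler_wpM2r ?prod_cnorm_ge0 // ler_wpM2l ?exprn_ge0 ?(ltW M0) //.
have -> : 1 + \sum_(1 <= j < size s) 2 ^+ j = \sum_(0 <= j < size s) 2 ^+ j :> R.
  by rewrite [RHS]big_ltn // expr0.
by rewrite sum_pow2; lra.
Qed.

Let K := 2 * M.
Let K0 : 0 < K. Proof. by rewrite mulr_gt0. Qed.

(** Up to the factor K^2 this bounds sigma on words, by [bcum_bound]; being
    submultiplicative, it extends to products of words. *)
Definition word_weight (w : tword B B) : R := K ^+ size w.2 * (cnorm w.1 * cn w.2).

Lemma word_weight_ge0 w : 0 <= word_weight w.
Proof.
by rewrite !mulr_ge0 ?exprn_ge0 ?(ltW K0) ?cnorm_ge0 ?prod_cnorm_ge0.
Qed.

Lemma word_weightM w w' :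
  word_weight (nc_wmul w w') <= word_weight w * word_weight w'.
Proof.
case: w => b s; rewrite /nc_wmul /=; elim: s b => [|c s IH] b /=.
  rewrite /word_weight /= expr0 big_nil mul1r mulr1 [leRHS]mulrCA.
  rewrite ler_wpM2l ?exprn_ge0 ?(ltW K0) // mulrA.
  by rewrite ler_wpM2r ?prod_cnorm_ge0 ?cnormM.
have -> : word_weight (b, c :: s) = K * cnorm b * word_weight (c, s).
  by rewrite /word_weight /= exprS big_cons; ring.
have -> : word_weight (b, (Defs.glue c s w').1 :: (Defs.glue c s w').2) =
    K * cnorm b * word_weight (Defs.glue c s w').
  by rewrite /word_weight /= exprS big_cons; ring.
rewrite -[leRHS]mulrA; apply: ler_wpM2l; last exact: IH.
by rewrite mulr_ge0 ?cnorm_ge0 ?(ltW K0).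
Qed.

Definition word_bounded (f : ncpoly B) (c : R) : Prop :=
  exists2 w, f = ncword w & word_weight w <= c.

Lemma word_boundedM f g c d : word_bounded f c -> word_bounded g d -> word_bounded (f * g) (c * d).
Proof.
move=> [w -> wc] [w' -> wd]; exists (nc_wmul w w'); first exact: ncwordM.
apply: le_trans (word_weightM _ _) _.
by apply: ler_pM; rewrite ?word_weight_ge0.
Qed.

Lemma word_bounded_refl w : word_bounded (ncword w) (word_weight w).
Proof. by exists w. Qed.

Lemma word_boundedX : word_bounded X K.
Proof.
exists (1, [:: 1]) => //; rewrite /word_weight /= big_seq1 expr1.
by rewrite ler_piMr ?(ltW K0) // mulr_ile1 ?cnorm_ge0 ?cnorm1.
Qed.

Lemma word_bounded_ncC b : word_bounded (ncC b) (cnorm b).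
Proof. by exists (b, [::]) => //; rewrite /word_weight /= big_nil expr0 mul1r mulr1. Qed.

Lemma word_bounded_exp m : word_bounded (X ^+ m) (K ^+ m).
Proof.
elim: m => [|m IH]; last by rewrite !exprS; apply: word_boundedM => //; exact: word_boundedX.
have [w e le] := word_bounded_ncC 1; exists w; first by rewrite -e ncC1.
by rewrite expr0 (le_trans le) ?cnorm1.
Qed.

Lemma sigma_word_le f c : word_bounded f c -> cnorm (sigma f) <= K ^+ 2 * c.
Proof.
move=> [w -> wc]; rewrite sigma_of_word.
apply: le_trans (bcum_bound _) _; first by rewrite size_rcons.
apply: (@le_trans _ _ (K ^+ 2 * word_weight w)); last first.
  by rewrite ler_wpM2l ?exprn_ge0 ?(ltW K0).
have -> : K ^+ size (rcons (w.1 :: w.2) 1) * cn (rcons (w.1 :: w.2) 1) =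
    K ^+ 2 * word_weight w * cnorm (1 : B).
  rewrite size_rcons -cats1 big_cat big_seq1 big_cons /word_weight /= !exprS expr0.
  by ring.
by rewrite ler_piMr ?cnorm1 // mulr_ge0 ?word_weight_ge0 ?exprn_ge0 ?(ltW K0).
Qed.

Lemma sigma_of_propertyE : propertyE sigma.
Proof.
exists (K * (1 + K) ^+ 2); split=> [|s].
  by rewrite mulr_gt0 ?exprn_gt0 ?addr_gt0.
have h : word_bounded (X * \prod_(b <- s) (ncC b * X)) (K ^+ (size s).+1 * cn s).
  suff h : word_bounded (\prod_(b <- s) (ncC b * X)) (K ^+ size s * cn s).
    by rewrite exprS -mulrA; apply: word_boundedM => //; exact: word_boundedX.
  elim: s => [|b s IH]; first by rewrite !big_nil mulr1; exact: (word_bounded_exp 0).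
  rewrite !big_cons /= exprS.
  have -> : K * K ^+ size s * (cnorm b * cn s) = cnorm b * K * (K ^+ size s * cn s) by ring.
  apply: word_boundedM => //.
  by apply: word_boundedM; [exact: word_bounded_ncC|exact: word_boundedX].
apply: le_trans (sigma_word_le h) _; rewrite mulrA ler_wpM2r ?prod_cnorm_ge0 //.
rewrite [in leRHS]exprMn [leLHS]mulrC ler_wpM2l ?exprn_ge0 ?(ltW K0) // -exprM.
have k1 : 1 <= 1 + K by rewrite lerDl ltW.
apply: (@le_trans _ _ ((1 + K) ^+ 2)).
  by rewrite ler_pXn2r ?nnegrE ?addr_ge0 ?(ltW K0) // lerDr.
by rewrite ler_weXn2l // leq_pmulr.
Qed.

Lemma sigma_sum (I : Type) (s : seq I) (F : I -> ncpoly B) :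
  sigma (\sum_(i <- s) F i) = \sum_(i <- s) sigma (F i).
Proof.
have [sg sgE] := exists_linear (sigma_of_linear iota mu).
by rewrite -sgE linear_sum; apply: eq_bigr => i _; rewrite sgE.
Qed.

Lemma sigma_growth f g : exists C, forall m, cnorm (sigma (f * X ^+ m * g)) <= C * K ^+ m.
Proof.
exists (\sum_(v <- repr f) \sum_(w <- repr g) K ^+ 2 * (word_weight v * word_weight w)) => m.
rewrite {1}(ncpoly_sum_words f) {1}(ncpoly_sum_words g) !mulr_suml sigma_sum.
apply: le_trans (cnorm_sum _ _ _) _; apply: ler_sum => v _.
rewrite mulr_sumr sigma_sum mulr_suml; apply: le_trans (cnorm_sum _ _ _) _.
apply: ler_sum => w _.
have h := word_boundedM (word_boundedM (word_bounded_refl v) (word_bounded_exp m))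
  (word_bounded_refl w).
by apply: le_trans (sigma_word_le h) _; rewrite (mulrAC (word_weight v)) [leLHS]mulrA.
Qed.

End Moments.

(** * Operator bounds for the form of a positive map *)

Section GNS.
Variables (R : realType) (B D : cstarAlgType R) (sigma : {linear ncpoly B -> D}).
Hypothesis sigmaP : propertyP sigma.
Variable K : R.
Hypotheses (K0 : 0 < K) (sigma_grow : forall f g, exists C, forall m,
  cnorm (sigma (f * ncX B ^+ m * g)) <= C * K ^+ m).
Local Notation X := (ncX B).

Section Form.
Variable n : nat.
Implicit Types F G : 'cV[ncpoly B]_n.

Definition gns_form F G : D := \sum_i sigma (star (F i 0) * G i 0).
Definition gns_norm F : R := Num.sqrt (cnorm (gns_form F F)).

(** The 2 x 2 Gram matrix of F and G is a sum of matrices covered by (P), thus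
    again some c^* c, and the columns of c represent F and G in D^2. *)
Lemma gns_form_gram F G : exists x y : 'cV[D]_2,
  [/\ gns_form F F = col_ip x x, gns_form F G = col_ip x y & gns_form G G = col_ip y y].
Proof.
pose h i (k : 'I_2) := if k == 0 then F i 0 else G i 0.
have [c ec] : psdmx (\sum_i \matrix_(k < 2, l < 2) sigma (star (h i k) * h i l)).
  by apply: psdmx_sum => i _; exact: sigmaP.
have ip_cols k l : col_ip (col k c) (col l c) = \sum_i sigma (star (h i k) * h i l).
  have /matrixP/(_ k l) := ec; rewrite summxE; under eq_bigr do rewrite mxE.
  move=> ->; rewrite /col_ip [in LHS]mxE [RHS]mxE.
  by apply: eq_bigr => j _; rewrite !adjmxE !mxE.
by exists (col 0 c), (col 1 c); rewrite !ip_cols.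
Qed.

Lemma gns_form_cauchy_schwarz F G : cnorm (gns_form F G) <= gns_norm F * gns_norm G.
Proof.
have [x [y [exx exy eyy]]] := gns_form_gram F G.
by rewrite /gns_norm exx exy eyy -!colnormE cauchy_schwarz.
Qed.

Lemma gns_norm_ge0 F : 0 <= gns_norm F. Proof. exact: sqrtr_ge0. Qed.

Lemma gns_norm_sqr F : gns_norm F ^+ 2 = cnorm (gns_form F F).
Proof. by rewrite sqr_sqrtr // cnorm_ge0. Qed.

Lemma gns_form_sqr F : exists z, gns_form F F = star z * z.
Proof. by have [x [_ [-> _ _]]] := gns_form_gram F F; exact: col_ip_sqr. Qed.

Definition X_act m F : 'cV[ncpoly B]_n := map_mx (fun f => X ^+ m * f) F.

Lemma star_Xexp m : star (X ^+ m) = X ^+ m.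
Proof.
elim: m => [|m IH]; first by rewrite expr0 star1.
by rewrite {1}exprS starM ncX_star IH exprSr.
Qed.

Lemma gns_form_X_act m k F G : gns_form (X_act m F) (X_act k G) = gns_form F (X_act (m + k) G).
Proof.
apply: eq_bigr => i _; rewrite !mxE starM star_Xexp exprD.
by rewrite !mulrA.
Qed.

(** X is symmetric for the form, so Cauchy-Schwarz says that the norms of X^m F
    are log-convex in m. *)
Lemma gns_norm_X F : gns_norm (X%:M *m F) <= K * gns_norm F.
Proof.
have X_act1 : X%:M *m F = X_act 1 F by apply/matrixP => i j; rewrite mul_scalar_mxE mxE.
have X_act0 : F = X_act 0 F by apply/matrixP => i j; rewrite mxE expr0 mul1r.
have [C hC] : exists C, forall m, cnorm (gns_form F (X_act m F)) <= C * K ^+ m.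
  have [c hc] := choice (fun i => sigma_grow (star (F i 0)) (F i 0)).
  exists (\sum_i c i) => m; apply: le_trans (cnorm_sum _ _ _) _; rewrite mulr_suml.
  by apply: ler_sum => i _; rewrite mxE mulrA.
rewrite X_act1 {2}X_act0.
apply: (@logconvex_growth _ (fun m => gns_norm (X_act m F)) C) => // m.
- exact: gns_norm_ge0.
- rewrite gns_norm_sqr gns_form_X_act -[(m.+1 + m.+1)%N]/(m.+1 + m.+1)%N addSnnS -gns_form_X_act.
  exact: gns_form_cauchy_schwarz.
- by rewrite gns_norm_sqr gns_form_X_act -exprM mul2n -addnn.
Qed.

End Form.

Lemma gns_form_adj n (b : 'M[B]_n) F G :
  gns_form (map_mx (@ncC _ B) b *m F) G = gns_form F (map_mx (@ncC _ B) (adjmx b) *m G).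
Proof.
rewrite /gns_form; under eq_bigr do rewrite mxE star_sum mulr_suml linear_sum.
rewrite exchange_big; apply: eq_bigr => j _.
rewrite mxE mulr_sumr linear_sum; apply: eq_bigr => i _.
by rewrite !mxE starM ncC_star mulrA.
Qed.

(** If r^2 - b^* b = c^* c then r^2 <F, F> = <b F, b F> + <c F, c F>. *)
Lemma gns_norm_mulC n (b : 'M[B]_n.+1) (F : 'cV[ncpoly B]_n.+1) (r : R) :
  0 < r -> mxcnorm b <= r -> gns_norm (map_mx (@ncC _ B) b *m F) <= r * gns_norm F.
Proof.
move=> r0 br; have [c ec] := mxcnorm_complement r0 br.
have gD G H H' : gns_form G (H + H') = gns_form G H + gns_form G H' :> D.
  by rewrite /gns_form -big_split; apply: eq_bigr => i _; rewrite mxE mulrDr linearD.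
have [x ex] := gns_form_sqr (map_mx (@ncC _ B) b *m F).
have [y ey] := gns_form_sqr (map_mx (@ncC _ B) c *m F).
have [z ez] := gns_form_sqr F.
have gz G w : gns_form G G = star w * w -> gns_norm G = cnorm w.
  by move=> e; rewrite /gns_norm e cstar_identity sqrtr_sqr ger0_norm ?cnorm_ge0.
rewrite (gz _ _ _ ex) (gz _ _ _ ez) -[r in leRHS]gtr0_norm // -cnorm_scale.
apply: (@star_mul_le _ _ _ y); rewrite -ex -ey !gns_form_adj -gD !mulmxA -mulmxDl.
have ncCmxM (a a' : 'M[B]_n.+1) :
    map_mx (@ncC _ B) a *m map_mx (@ncC _ B) a' = map_mx (@ncC _ B) (a *m a').
  apply/matrixP => i j; rewrite !mxE (big_morph _ (@ncCD _ B) (@ncC0 _ B)).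
  by apply: eq_bigr => k _; rewrite !mxE ncCM.
have ncCmxD (a a' : 'M[B]_n.+1) :
    map_mx (@ncC _ B) a + map_mx (@ncC _ B) a' = map_mx (@ncC _ B) (a + a').
  by apply/matrixP => i j; rewrite !mxE ncCD.
rewrite !ncCmxM ncCmxD -ec addrC subrK.
rewrite star_scale -scalerAl -scalerAr scalerA -rmorphM -expr2 -ez /gns_form.
rewrite scaler_sumr; apply: eq_bigr => i _.
have -> : map_mx (@ncC _ B) (((r ^+ 2)%:C *: 1)%:M) = (((r ^+ 2)%:C *: 1)%:M : 'M[ncpoly B]_n.+1).
  apply/matrixP => k l; rewrite !mxE; case: eqP => _; rewrite ?mulr1n ?mulr0n ?ncC0 //.
  by rewrite ncCZ ncC1.
by rewrite mul_scalar_mxE -scalerAl mul1r -scalerAr linearZ.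
Qed.

(** The (i, j) entry is the form of the basis columns e_i and b (X b)^k e_j. *)
Lemma sigma_series_bound n (b : 'M[B]_n.+1) (r : R) : 0 < r -> mxcnorm b <= r ->
  forall i j, exists C, forall k,
   cnorm (sigma ((map_mx (@ncC _ B) b *m Xb b ^+ k) i j)) <= C * (K * r) ^+ k.
Proof.
move=> r0 br i j; pose e l : 'cV[ncpoly B]_n.+1 := delta_mx l 0.
have eE l l' : e l l' 0 = (l' == l)%:R by rewrite mxE andbT.
have mul_e (a : 'M[ncpoly B]_n.+1) l l' : (a *m e l') l 0 = a l l'.
  by rewrite -colE mxE.
exists (gns_norm (e i) * r * gns_norm (e j)) => k.
have Xbn m : gns_norm (Xb b ^+ m *m e j) <= (K * r) ^+ m * gns_norm (e j).
  elim: m => [|m IH]; first by rewrite !expr0 mul1mx mul1r.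
  rewrite exprS -mulmxE -mulmxA /Xb -/(Xb b) -mulmxA.
  apply: le_trans (gns_norm_X _) _; rewrite exprS -!mulrA ler_pM2l //.
  by apply: le_trans (gns_norm_mulC _ r0 br) _; rewrite ler_pM2l // mulrA.
have -> : sigma ((map_mx (@ncC _ B) b *m Xb b ^+ k) i j) =
    gns_form (e i) (map_mx (@ncC _ B) b *m Xb b ^+ k *m e j).
  rewrite /gns_form (bigD1 i) //= big1 => [|l /negPf li].
    by rewrite addr0 eE eqxx star1 mul1r mul_e.
  by rewrite eE li star0 mul0r linear0.
apply: le_trans (gns_form_cauchy_schwarz _ _) _; rewrite -!mulrA.
apply: ler_wpM2l; first exact: gns_norm_ge0.
rewrite -mulmxA; apply: le_trans (gns_norm_mulC _ r0 br) _.
by rewrite ler_pM2l // mulrC.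
Qed.

End GNS.

(** * Convergence near zero *)

Lemma mxcvg_beta (R : realType) (B D : cstarAlgType R) (iota : {lrmorphism B -> D})
    (mu : {linear ncpoly B -> D}) (muS : in_Sigma iota mu) n (b : 'M[B]_n) (S : 'M[D]_n) :
  mxcvg (fun N => \sum_(0 <= k < N)
    map_mx (sigma_of iota mu) (map_mx (@ncC _ B) b *m Xb b ^+ k)) S ->
  mxcvg (fun N => \sum_(1 <= k < N) map_mx (boolean_beta iota mu) (Xb b ^+ k))
    (((mu (ncX B))%:M + S) *m map_mx iota b).
Proof.
move=> hS i j; apply: cvg0_shift2 => [N|]; first exact: cnorm_ge0.
have diff N : (\sum_(1 <= k < N.+2) map_mx (boolean_beta iota mu) (Xb b ^+ k)) i j -
    (((mu (ncX B))%:M + S) *m map_mx iota b) i j =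
    \sum_l (((\sum_(0 <= k < N) map_mx (sigma_of iota mu)
      (map_mx (@ncC _ B) b *m Xb b ^+ k)) i l - S i l) * iota (b l j)).
  rewrite (beta_Xb_sum muS) !mxE -sumrB; apply: eq_bigr => l _.
  by rewrite -mulrBl !mxE opprD addrACA subrr add0r.
apply: (@squeeze_cvgr _ _ _ _ (fun=> 0) (fun N => \sum_l (cnorm ((\sum_(0 <= k < N)
   map_mx (sigma_of iota mu) (map_mx (@ncC _ B) b *m Xb b ^+ k)) i l - S i l)
   * cnorm (iota (b l j))))).
- apply: nearW => N; rewrite cnorm_ge0 diff; apply: le_trans (cnorm_sum _ _ _) _.
  by apply: ler_sum => l _; exact: cnormM.
- exact: cvg_cst.
- apply: cvg0_sum => l; rewrite -[X in (_ --> X)%classic](mul0r (cnorm (iota (b l j)))).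
  by apply: cvgM; [exact: hS|exact: cvg_cst].
Qed.

(** * The theorem *)

Local Close Scope complex_scope.
Unset Implicit Arguments.

Theorem theorem5p6 (R : realType) (B D : cstarAlgType R)
    (iota : {lrmorphism B -> D}) (iotaP : cstar_inclusion iota)
    (mu : {linear ncpoly B -> D}) (muP : in_Sigma iota mu) :
  exists (alpha : D) (sigma : {linear ncpoly B -> D}),
    [/\ star alpha = alpha,
        propertyP sigma,
        (forall (n : nat) (b : 'M[B]_n), (0 < n)%N -> Nilp b ->
           Bfun iota mu b =
             (alpha%:M + map_mx sigma (map_mx (@ncC _ B) b *m resolvent b))
               *m map_mx iota b) &
        (in_Sigma0 iota mu ->
           propertyE sigma /\
           exists delta : R, 0 < delta /\
             forall (n : nat) (b : 'M[B]_n), (0 < n)%N -> mxcnorm b < delta ->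
             exists L S : 'M[D]_n,
               [/\ mxcvg (fun N => \sum_(1 <= k < N)
                            map_mx (boolean_beta iota mu) (Xb b ^+ k)) L,
                   mxcvg (fun N => \sum_(0 <= k < N)
                            map_mx sigma (map_mx (@ncC _ B) b *m Xb b ^+ k)) S &
                   L = (alpha%:M + S) *m map_mx iota b])].
Proof.
have [sigma /funext sE] := exists_linear (sigma_of_linear iota mu).
have sigmaP : propertyP sigma by rewrite sE; exact: sigma_of_propertyP muP.
exists (mu (ncX B)), sigma; split=> //.
- by rewrite -(hermitian_of_propertyP _ (Sigma_P muP)) ncX_star.
- by move=> n b _ nb; rewrite sE; exact: boolean_identity nb.
move=> [_ [M [M0 muM]]]; split.
  by rewrite sE; exact (sigma_of_propertyE iotaP muP M0 muM).
have K0 : 0 < 2 * M by rewrite mulr_gt0.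
have grow f g : exists C, forall m,
    cnorm (sigma (f * ncX B ^+ m * g)) <= C * (2 * M) ^+ m.
  by rewrite sE; exact (sigma_growth iotaP muP M0 muM f g).
(* The ratio 2 M delta of the dominating geometric series is 1/2. *)
pose delta : R := (2 * (2 * M))^-1.
have d0 : 0 < delta by rewrite invr_gt0 mulr_gt0.
exists delta; split=> // -[//|n] b _ /ltW bd.
have Kd : 2 * M * delta = 2^-1 by rewrite /delta invfM mulrCA divff ?gt_eqF // mulr1.
have hS i j : exists s : D, ((fun N => cnorm (\sum_(0 <= k < N)
    sigma ((map_mx (@ncC _ B) b *m Xb b ^+ k) i j) - s)) @ \oo --> (0 : R))%classic.
  have [C hC] := sigma_series_bound sigmaP K0 grow d0 bd i j.
  by apply: (@geometric_series_cvg _ _ _ C) => k; rewrite -Kd.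
pose S : 'M[D]_n.+1 := \matrix_(i, j) projT1 (choice (hS i)) j.
have cS : mxcvg (fun N => \sum_(0 <= k < N)
    map_mx sigma (map_mx (@ncC _ B) b *m Xb b ^+ k)) S.
  move=> i j.
  have entry N : (\sum_(0 <= k < N) map_mx sigma (map_mx (@ncC _ B) b *m Xb b ^+ k)) i j
      - S i j = \sum_(0 <= k < N) sigma ((map_mx (@ncC _ B) b *m Xb b ^+ k) i j)
      - projT1 (choice (hS i)) j.
    rewrite summxE [S i j]mxE; congr (_ - _); apply: eq_bigr => k _.
    by rewrite [LHS]mxE.
  under eq_fun do rewrite entry.
  exact: (projT2 (choice (hS i)) j).
exists (((mu (ncX B))%:M + S) *m map_mx iota b), S; split=> //.
by apply: mxcvg_beta => //; rewrite -sE.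
Qed.
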